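(* A simple oriented matroid is FL-isomorphic to the big oriented matroid $\mathcal B(\mathcal M)$ of some sweep oriented matroid $\mathcal M$ if and only if it has a tight modular hyperplane.
   Context: Oriented matroids are given by covectors (standard covector axioms), ordered componentwise by $0\prec\pm$; the rank is the length of maximal chains of covectors. The big face lattice is the poset of covectors with a top element adjoined; two oriented matroids are FL-isomorphic if their big face lattices are isomorphic. A loop is an element that is $0$ in every covector; $e,f$ are parallel if $X_e=X_f$ for all covectors or $X_e=-X_f$ for all covectors; an oriented matroid is simple if it has no loops and no two distinct parallel elements. A flat is the zero set of a covector; flats ordered by inclusion form a geometric lattice, the rank of a flat $F$ is the rank of the restriction $\mathcal M|_F=\{X|_F\}$; a hyperplane is a flat of rank $r-1$ where $r$ is the rank of the oriented matroid. A flat $F$ is modular if $\mathrm{rk}(F)+\mathrm{rk}(G)=\mathrm{rk}(F\wedge G)+\mathrm{rk}(F\vee G)$ for every flat $G$. A modular hyperplane $F$ of an oriented matroid on $E$ is tight if there is no $z\in F$ such that $F\setminus\{z\}$ is a modular hyperplane of the restriction to $E\setminus\{z\}$. Sweep oriented matroids and big oriented matroids: $\binom{[n]}{2}$ is the set of pairs $(i,j)$, $i<j$; for an ordered partition $I$ of $[n]$ with block-index map $p_I$, $X^I_{(i,j)}=+,-,0$ according as $p_I(i)<,>,=p_I(j)$; a sweep oriented matroid is an oriented matroid on $\binom{[n]}{2}$ all of whose covectors are of the form $X^I$. For such a covector $X=X^{I_X}$ with $l_X$ blocks and $p_X=p_{I_X}$, and $1\le k\le 2l_X+1$, $X^k$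 on $[n]\cup\binom{[n]}{2}$ has $X^k_{(i,j)}=X_{(i,j)}$ and $X^k_i=-$ if $p_X(i)\le\lfloor\frac{k-1}{2}\rfloor$, $+$ if $p_X(i)>\lfloor\frac k2\rfloor$, $0$ if $k$ even and $p_X(i)=\frac k2$; $\mathcal B(\mathcal M)=\{X^k\}$. *)

(* Defs.v *)
From HB Require Import structures.
From mathcomp Require Import all_boot.

Set Implicit Arguments.
Unset Strict Implicit.
Unset Printing Implicit Defensive.

(** * Signs and sign vectors *)

Inductive sign : predArgType := Neg | Zero | Pos.

Definition option_of_sign (s : sign) : option bool :=
  match s with Neg => Some false | Zero => None | Pos => Some true end.
Definition sign_of_option (o : option bool) : sign :=
  match o with Some false => Neg | None => Zero | Some true => Pos end.
Lemma option_of_signK : cancel option_of_sign sign_of_option.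
Proof. by case. Qed.
HB.instance Definition _ := Finite.copy sign (can_type option_of_signK).

Definition opp_sign (s : sign) : sign :=
  match s with Neg => Pos | Zero => Zero | Pos => Neg end.

Notation signvec E := {ffun E -> sign}.

Section SignVectors.
Variable E : finType.
Implicit Types X Y : signvec E.

Definition zero_vec : signvec E := [ffun=> Zero].
Definition opp_vec X : signvec E := [ffun e => opp_sign (X e)].
Definition comp_vec X Y : signvec E :=
  [ffun e => if X e == Zero then Y e else X e].
Definition separation X Y : {set E} :=
  [set e | (X e != Zero) && (X e == opp_sign (Y e))].
Definition zero_set X : {set E} := [set e | X e == Zero].
Definition le_vec X Y : bool := [forall e, (X e == Zero) || (X e == Y e)].

Definition is_chain (C : {set signvec E}) : bool :=
  [forall X in C, forall Y in C, le_vec X Y || le_vec Y X].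

(* A chain with c elements has length c - 1. *)
Definition rank (L : {set signvec E}) : nat :=
  \max_(C : {set signvec E} | (C \subset L) && is_chain C) #|C|.-1.

End SignVectors.

(** * Oriented matroids, given by their sets of covectors *)

Section OrientedMatroids.
Variable E : finType.
Implicit Types (L : {set signvec E}) (F G : {set E}).

Definition oriented_matroid L : Prop :=
  [/\ zero_vec E \in L,
      forall X, X \in L -> opp_vec X \in L,
      forall X Y, X \in L -> Y \in L -> comp_vec X Y \in L
    & forall X Y e, X \in L -> Y \in L -> e \in separation X Y ->
        exists2 Z, Z \in L &
          Z e = Zero /\
          forall f, f \notin separation X Y -> Z f = comp_vec X Y f].

Definition loop L (e : E) : Prop := forall X, X \in L -> X e = Zero.
Definition parallel L (e f : E) : Prop :=
  (forall X, X \in L -> X e = X f) \/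
  (forall X, X \in L -> X e = opp_sign (X f)).
Definition simple_om L : Prop :=
  (forall e, ~ loop L e) /\ (forall e f, e != f -> ~ parallel L e f).

Definition restrict_vec (A : {set E}) (X : signvec E) :
  signvec {x : E | x \in A} := [ffun x => X (val x)].
Definition restrict L (A : {set E}) : {set signvec {x : E | x \in A}} :=
  [set restrict_vec A X | X in L].

Definition flat L F : bool := [exists X in L, F == zero_set X].

Definition flat_rank L F : nat := rank (restrict L F).

(* Meet and join in the lattice of flats ordered by inclusion; see
   [flat_meet_flat] and [flat_join_flat] below. *)
Definition flat_meet F G : {set E} := F :&: G.
Definition flat_join L F G : {set E} :=
  \bigcap_(H : {set E} | flat L H && (F :|: G \subset H)) H.

Definition modular_flat L F : Prop :=
  flat L F /\
  forall G, flat L G ->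
    flat_rank L F + flat_rank L G =
    flat_rank L (flat_meet F G) + flat_rank L (flat_join L F G).

Definition hyperplane L F : Prop :=
  flat L F /\ (flat_rank L F).+1 = rank L.

Definition modular_hyperplane L F : Prop :=
  hyperplane L F /\ modular_flat L F.

Lemma flat_meet_flat L F G :
  oriented_matroid L -> flat L F -> flat L G -> flat L (flat_meet F G).
Proof.
case=> _ _ hcomp _ /exists_inP[X XL /eqP->] /exists_inP[Y YL /eqP->].
apply/exists_inP; exists (comp_vec X Y); first exact: hcomp.
apply/eqP/setP => e; rewrite !inE ffunE.
by case: (eqVneq (X e) Zero) => [|/negPf ->].
Qed.

Lemma flat_join_flat L F G : oriented_matroid L -> flat L (flat_join L F G).
Proof.
move=> hL; rewrite /flat_join.
apply: (big_ind (flat L)) => [|A B|H /andP[]//]; last exact: flat_meet_flat.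
case: hL => h0 _ _ _; apply/exists_inP; exists (zero_vec E) => //.
by apply/eqP/setP => e; rewrite !inE ffunE eqxx.
Qed.

End OrientedMatroids.

Definition tight_modular_hyperplane (E : finType) (L : {set signvec E})
    (F : {set E}) : Prop :=
  modular_hyperplane L F /\
  forall z, z \in F ->
    ~ modular_hyperplane (restrict L [set~ z])
        [set x : {x : E | x \in [set~ z]} | val x \in F].

(** * Big face lattices *)

(* [None] is the adjoined top element. *)
Definition big_face (E : finType) (L : {set signvec E}) : Type :=
  option {X : signvec E | X \in L}.

Definition big_face_le (E : finType) (L : {set signvec E})
    (x y : big_face L) : bool :=
  match x, y with
  | _, None => true
  | None, Some _ => false
  | Some X, Some Y => le_vec (val X) (val Y)
  end.

Definition FL_isomorphic (E E' : finType)
    (L : {set signvec E}) (L' : {set signvec E'}) : Prop :=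
  exists2 f : big_face L -> big_face L', bijective f &
    forall x y, big_face_le (f x) (f y) = big_face_le x y.

(** * Sweep oriented matroids and big oriented matroids *)

Section Sweep.
Variable n : nat.

Definition ipair : Type := {p : 'I_n * 'I_n | p.1 < p.2}.
HB.instance Definition _ := Finite.on ipair.

Definition ordered_partition (I : seq {set 'I_n}) : bool :=
  uniq I && partition [set:: I] [set: 'I_n].

(* Blocks are numbered from 1. *)
Definition block_index (I : seq {set 'I_n}) (i : 'I_n) : nat :=
  (find (fun B : {set 'I_n} => i \in B) I).+1.

Definition sweep_covector (I : seq {set 'I_n}) : signvec ipair :=
  [ffun ij => let pi := block_index I (val ij).1 in
              let pj := block_index I (val ij).2 in
              if pi < pj then Pos else if pj < pi then Neg else Zero].

Definition sweep_oriented_matroid (M : {set signvec ipair}) : Prop :=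
  oriented_matroid M /\
  forall X, X \in M ->
    exists2 I : seq {set 'I_n}, ordered_partition I & X = sweep_covector I.

(* For k > 0, the last case below occurs exactly when k is even and
   block_index I i = k / 2. *)
Definition big_covector (I : seq {set 'I_n}) (k : nat) :
    signvec ('I_n + ipair)%type :=
  [ffun e => match e with
             | inl i => if block_index I i <= k.-1./2 then Neg
                        else if k./2 < block_index I i then Pos else Zero
             | inr ij => sweep_covector I ij
             end].

(* Ordered partitions of [n] have l <= n blocks, so the quantifiers are finite;
   k ranges over 1, ..., 2 l + 1. *)
Definition big_om (M : {set signvec ipair}) :
    {set signvec ('I_n + ipair)%type} :=
  [set Y | [exists l : 'I_n.+1, exists I : l.-tuple {set 'I_n},
            exists k : 'I_(2 * l).+2,
            [&& ordered_partition I, sweep_covector I \in M, 0 < k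
              & Y == big_covector I k]]].

End Sweep.

(* Main.v *)
Require Import Defs.
From mathcomp Require Import all_boot.
From mathcomp Require Import zify.

Set Implicit Arguments.
Unset Strict Implicit.
Unset Printing Implicit Defensive.

(** A proper flat F is a modular hyperplane iff every line through two
    elements i, j outside F meets F, say in z_ij; tightness then says that
    every element of F is the only point of F on some such line.  In
    B(M) the element (i,j) lies on the line through i and j, as its sign is
    that of x_j - x_i.  Conversely, reorient so that the covector P with zero
    set F is positive outside F and z_ij has the sign of x_j - x_i: adding
    multiples of P shifts all x_i simultaneously, so that the covectors of the
    restriction to F are given by ordered partitions and the covectors above
    one of them are exactly its cuts.

    The face lattice determines the zero sets of covectors: the number of
    parallel classes separating two topes is their distance in the tope graph,
    and the two sides of the hyperplane of e are told apart by the distances to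
    two topes adjacent across it. *)

(** * Elimination, closure and the exchange property *)

(** An FL-isomorphism gives no bijection of ground sets: B(M) may have loops and parallel elements,
    since a pair can vanish on all of M or have the same zeros as another pair. Hence elements are
    compared only through their zeros and the closure operator. Starting from B(M), each element of
    L is matched with some element of B(M) with the same zeros; in the other direction the sweep
    model is a reoriented copy of L in which a point of F may be repeated for several pairs, which
    leaves the face poset unchanged. Two obstacles shape the proof. Rank is defined by chains of
    covectors while modularity is a matroid count, so chains are turned into bases of the closure.
    And B(M) must be shown to be an oriented matroid: a covector of M that eliminates on the pairs
    may put the eliminated index on the wrong side of indices whose signs are prescribed, and the
    correction has to take place inside M. The condition 0 < n supplies an element outside the
    hyperplane. *)

Definition comp_sign (a b : sign) : sign := if a == Zero then b else a.
Definition opposite (a b : sign) : bool := (a != Zero) && (a == opp_sign b).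

Lemma opp_signK : involutive opp_sign. Proof. by case. Qed.

Lemma opp_sign_eq0 a : (opp_sign a == Zero) = (a == Zero).
Proof. by case: a. Qed.

Lemma oppositeC a b : opposite a b = opposite b a.
Proof. by case: a b => [] []. Qed.

Lemma comp_signC a b : ~~ opposite a b -> comp_sign a b = comp_sign b a.
Proof. by case: a b => [] []. Qed.

Section Elimination.
Variables (E : finType) (L : {set signvec E}).
Hypothesis hL : oriented_matroid L.
Implicit Types X Y Z : signvec E.

Lemma om_zero : zero_vec E \in L. Proof. by case: hL. Qed.

Lemma om_opp X : X \in L -> opp_vec X \in L. Proof. by case: hL => _ h _ _; apply: h. Qed.

Lemma om_comp X Y : X \in L -> Y \in L -> comp_vec X Y \in L.
Proof. by case: hL => _ _ h _; apply: h. Qed.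

Lemma om_elim X Y e : X \in L -> Y \in L -> opposite (X e) (Y e) ->
  exists2 Z, Z \in L & Z e = Zero /\
    forall f, ~~ opposite (X f) (Y f) -> Z f = comp_sign (X f) (Y f).
Proof.
case: hL => _ _ _ h XL YL hop.
have [|Z ZL [Ze Zf]] := h X Y e XL YL; first by rewrite inE.
exists Z => //; split=> // f hf; rewrite Zf ?inE // ffunE //.
Qed.

End Elimination.

Section LeVec.
Variable E : finType.
Implicit Types X Y Z : signvec E.

Lemma le_vecP X Y : reflect (forall e, X e != Zero -> X e = Y e) (le_vec X Y).
Proof.
apply: (iffP forallP) => h e; have := h e; first by case: eqP => //= _ /eqP.
by case: eqP => //= _ ->.
Qed.

Lemma le_vec_refl X : le_vec X X. Proof. exact/le_vecP. Qed.

Lemma le_vec_trans X Y Z : le_vec X Y -> le_vec Y Z -> le_vec X Z.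
Proof.
move=> /le_vecP h /le_vecP h'; apply/le_vecP => e he.
by rewrite h // h' // -h.
Qed.

Lemma le_vec_anti X Y : le_vec X Y -> le_vec Y X -> X = Y.
Proof.
move=> /le_vecP h /le_vecP h'; apply/ffunP => e.
have [Xe|] := eqVneq (X e) Zero; last exact: h.
have [Ye|Ye] := eqVneq (Y e) Zero; first by rewrite Xe.
by rewrite -h'.
Qed.

Lemma le0_vec X : le_vec (zero_vec E) X.
Proof. by apply/le_vecP => e; rewrite ffunE eqxx. Qed.

Lemma le_comp X Y : le_vec X (comp_vec X Y).
Proof. by apply/le_vecP => e /negPf h; rewrite ffunE h. Qed.

Lemma le_vec_zero X Y e : le_vec X Y -> Y e = Zero -> X e = Zero.
Proof.
move=> /le_vecP h Ye; apply/eqP/negPn/negP => /[dup] /h.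
by rewrite Ye => ->.
Qed.

Lemma le_vec_neq X Y : le_vec X Y -> X <> Y -> exists2 e, X e = Zero & Y e != Zero.
Proof.
move=> h /eqP hne; have /existsP[e /andP[/eqP ? ?]] : [exists e, (X e == Zero) && (Y e != Zero)].
  apply: contraR hne => /existsPn hn; apply/eqP/ffunP => e.
  have /nandP[Xe|/negPn/eqP Ye] := hn e; first exact: (le_vecP _ _ h).
  by rewrite Ye (le_vec_zero h Ye).
by exists e.
Qed.
End LeVec.

Section Span.
Variables (E : finType) (L : {set signvec E}).
Implicit Types (X Y Z : signvec E) (A B : {set E}) (s t : seq E).

(** Closure in the underlying matroid, read off the covectors: [span set0] is the set of loops, and
    the span of two independent elements is the line through them. *)
Definition span A : {set E} :=
  [set e | [forall X in L, [forall f in A, X f == Zero] ==> (X e == Zero)]].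

Lemma spanP A e :
  reflect (forall X, X \in L -> (forall f, f \in A -> X f = Zero) -> X e = Zero)
          (e \in span A).
Proof.
rewrite inE; apply: (iffP forall_inP) => h X XL.
  by move=> hA; apply/eqP/(implyP (h X XL))/forall_inP => f /hA ->.
by apply/implyP => /forall_inP hA; apply/eqP/h => // f /hA/eqP.
Qed.

Lemma spanPn A e : e \notin span A ->
  exists2 X, X \in L & (forall f, f \in A -> X f = Zero) /\ X e != Zero.
Proof.
rewrite inE => /forall_inPn[X XL]; rewrite negb_imply => /andP[/forall_inP hA he].
by exists X => //; split=> // f /hA/eqP.
Qed.

Lemma sub_span A : A \subset span A.
Proof. by apply/subsetP => e eA; apply/spanP => X _; apply. Qed.

Lemma mem_span A e : e \in A -> e \in span A.
Proof. exact/subsetP/sub_span. Qed.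

Lemma span_trans A B : A \subset span B -> span A \subset span B.
Proof.
move=> /subsetP hAB; apply/subsetP => e /spanP he; apply/spanP => X XL hB.
by apply: he => // f /hAB/spanP; apply.
Qed.

Lemma spanS A B : A \subset B -> span A \subset span B.
Proof. by move=> h; apply/span_trans/(subset_trans h)/sub_span. Qed.

Lemma span_join A B : flat_join L A B = span (A :|: B).
Proof.
apply/setP => e; apply/bigcapP/spanP => [h X XL hAB|h H].
  have /h : flat L (zero_set X) && (A :|: B \subset zero_set X).
    rewrite /flat; apply/andP; split; first by apply/exists_inP; exists X.
    by apply/subsetP => f /hAB hf; rewrite inE hf.
  by rewrite inE => /eqP.
move=> /andP[/exists_inP[X XL /eqP->] /subsetP hs]; rewrite inE; apply/eqP/h => // f.
by move=> /hs; rewrite inE => /eqP.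
Qed.

Lemma flat_closed F : flat L F -> span F = F.
Proof.
case/exists_inP => X XL /eqP->; apply/eqP; rewrite eqEsubset sub_span andbT.
apply/subsetP => e /spanP h; rewrite inE h // => f; by rewrite inE => /eqP.
Qed.

Hypothesis hL : oriented_matroid L.

Lemma span_flat A : flat L (span A).
Proof. by rewrite -[A]setU0 -span_join; apply: flat_join_flat. Qed.

(** Take Y vanishing on A but not at e, hence not at f. If X vanished on A and e but not at f,
    eliminating f between Y and X or its opposite would give a covector zero on A and f that still
    has the sign of Y at e. *)
Lemma span_exchange A e f :
  e \in span (f |: A) -> e \notin span A -> f \in span (e |: A).
Proof.
move=> he /spanPn[Y YL [YA Ye]]; apply/spanP => X XL XeA.
have Xe : X e = Zero by apply: XeA; rewrite !inE eqxx.
have XA g : g \in A -> X g = Zero by move=> gA; apply: XeA; rewrite inE gA orbT.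
apply/eqP/negPn/negP => Xf.
have Yf : Y f != Zero.
  apply: contra Ye => /eqP Yf; apply/eqP/(spanP _ _ he) => // g.
  by rewrite !inE => /orP[/eqP->|/YA].
wlog hop : X XL Xe XA Xf {XeA} / opposite (X f) (Y f).
  move=> hw; have [hop|hop] := boolP (opposite (X f) (Y f)); first exact: (hw X).
  apply: (hw (opp_vec X)); first exact: om_opp.
  - by rewrite ffunE Xe.
  - by move=> g gA; rewrite ffunE XA.
  - by rewrite ffunE opp_sign_eq0.
  - by rewrite ffunE; move: hop Xf Yf; case: (X f) (Y f) => [] [].
have [Z ZL [Zf hZ]] := om_elim hL XL YL hop.
have Ze : Z e = Y e by rewrite hZ Xe.
have : Z e = Zero.
  apply: (spanP _ _ he) => // g; rewrite !inE => /orP[/eqP->//|gA].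
  by rewrite hZ XA // YA.
by rewrite Ze => /eqP; rewrite (negPf Ye).
Qed.

(** Independence, tested from the end of the list: bases grow at the head. *)
Fixpoint free s : bool :=
  if s is e :: s' then (e \notin span [set:: s']) && free s' else true.

Lemma free_cons e s : free (e :: s) = (e \notin span [set:: s]) && free s.
Proof. by []. Qed.

Lemma set_cons e s : [set:: e :: s] = e |: [set:: s].
Proof. by apply/setP => f; rewrite !inE. Qed.

Lemma exchange_set A B e : e \notin span A -> e \in span (A :|: B) ->
  exists2 b, b \in B & A :|: B \subset span (e |: A :|: (B :\ b)).
Proof.
move=> eA eAB; pose P (C : {set E}) := (C \subset B) && (e \in span (A :|: C)).
(* Any member of a minimal part C of B that, with A, still spans e can be exchanged for e. *)
have [|C /minsetP[/andP[CB eC] Cmin] _] := @minset_exists _ P B.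
  by rewrite /P subxx.
have [C0|[b bC]] := set_0Vmem C; first by move: eC; rewrite C0 setU0 (negPf eA).
exists b; first exact: (subsetP CB).
have eCb : e \notin span (A :|: C :\ b).
  apply/negP => h; have := Cmin (C :\ b); rewrite /P h (subset_trans (subD1set _ _) CB) subD1set.
  by move=> /(_ isT isT) hC; move: bC; rewrite -hC !inE eqxx.
have /(span_exchange)/(_ eCb) hb : e \in span (b |: (A :|: C :\ b)).
  by rewrite setUCA setD1K.
have hb' : b \in span (e |: A :|: B :\ b).
  apply: (subsetP (spanS _) _ hb); rewrite -setUA setUS // setUS //; exact: setSD.
apply/subsetP => f; have [->//|fb] := eqVneq f b.
by rewrite inE => h; apply: mem_span; rewrite !inE fb; case/orP: h => ->; rewrite ?orbT.
Qed.

Lemma steinitz B s : free s -> [set:: s] \subset span B -> size s <= #|B|.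
Proof.
(* Strengthened for the induction: C is what remains of B after each entry of s has replaced one
   element. *)
move=> fs sB; suff [C] : exists2 C : {set E}, #|C| + size s <= #|B| & B \subset span ([set:: s] :|: C).
  by lia.
elim: s fs sB => [|e s IH] /=; first by exists B; rewrite ?addn0 // set_nil set0U sub_span.
rewrite set_cons subUset sub1set => /andP[es fs] /andP[eB sB].
have [C hC BC] := IH fs sB.
have [|b bC hb] := @exchange_set [set:: s] C e es.
  exact: (subsetP (span_trans BC)).
exists (C :\ b); first by move: hC; rewrite (cardsD1 b C) bC; lia.
exact: subset_trans BC (span_trans hb).
Qed.

Lemma free_extend s t : free s ->
  exists2 u, {subset u <= t} & free (u ++ s) /\ [set:: t] \subset span [set:: u ++ s].
Proof.
move=> fs; elim: t => [|e t [u ut [fu tu]]].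
  by exists [::] => //; split=> //; rewrite set_nil sub0set.
have [he|he] := boolP (e \in span [set:: u ++ s]).
  exists u; first by move=> f /ut ft; rewrite inE ft orbT.
  by split=> //; rewrite set_cons subUset sub1set he.
exists (e :: u); first by move=> f; rewrite !inE => /orP[->//|/ut->]; rewrite orbT.
split=> /=; first by rewrite he.
rewrite set_cons subUset sub1set mem_span ?inE ?eqxx //.
by rewrite (subset_trans tu) // spanS // set_cons subsetUr.
Qed.

Lemma basis_exists A :
  exists2 s, {subset s <= A} & free s /\ A \subset span [set:: s].
Proof.
have [u uA [fu Au]] := @free_extend [::] (enum A) isT; rewrite cats0 in fu Au.
exists u; first by move=> e /uA; rewrite mem_enum.
by split=> //; rewrite (subset_trans _ Au) //; apply/subsetP => e; rewrite inE mem_enum.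
Qed.

End Span.

(** * Rank as the size of a basis *)

Section Rank.
Variables (E : finType) (L : {set signvec E}).
Hypothesis hL : oriented_matroid L.
Implicit Types (X Y Z : signvec E) (A B : {set E}) (s t : seq E) (C : {set signvec E}).

Lemma chainP C : reflect {in C &, forall X Y, le_vec X Y || le_vec Y X} (is_chain C).
Proof.
apply: (iffP forall_inP) => [h X Y XC YC|h X XC]; first exact: (forall_inP (h X XC)).
by apply/forall_inP => Y YC; apply: h.
Qed.

(* A witness Y for "e is not in the span of s" is composed with a chain
   whose members are already distinguished by their values on s. *)
Lemma free_chain s : free L s -> exists C, [/\ C \subset L, is_chain C,
   {in C &, forall X Y, {in s, X =1 Y} -> X = Y} & #|C| = (size s).+1].
Proof.
elim: s => [|e s IH] /=.
  exists [set zero_vec E]; split; rewrite ?cards1 ?sub1set ?om_zero //.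
    by apply/chainP => X Y /set1P-> /set1P->; rewrite le_vec_refl.
  by move=> X Y /set1P-> /set1P->.
move=> /andP[/spanPn[Y YL [Ys Ye]] /IH[C [CL Cch Cs Cc]]].
have Ys' f : f \in s -> Y f = Zero by move=> fs; apply: Ys; rewrite inE.
have hinj : {in C &, injective (comp_vec Y)}.
  move=> X X' XC X'C /ffunP hX; apply: Cs => // f fs.
  by have := hX f; rewrite !ffunE Ys'.
exists (zero_vec E |: [set comp_vec Y X | X in C]); split.
- rewrite subUset sub1set om_zero //; apply/subsetP => _ /imsetP[X XC ->].
  by apply: om_comp => //; apply: (subsetP CL).
- apply/chainP => X X' /setU1P[->|/imsetP[Z ZC ->]]; first by rewrite le0_vec.
  case/setU1P => [->|/imsetP[Z' ZC' ->]]; first by rewrite le0_vec orbT.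
  have le_comp2 U V : le_vec U V -> le_vec (comp_vec Y U) (comp_vec Y V).
    by move=> /le_vecP h; apply/le_vecP => f; rewrite !ffunE; have [_|] := eqVneq (Y f) Zero; [exact: h|].
  by have /orP[/le_comp2->|/le_comp2->] := chainP _ Cch _ _ ZC ZC'; rewrite ?orbT.
- move=> X X' /setU1P[->|/imsetP[Z ZC ->]] /setU1P[->|/imsetP[Z' ZC' ->]] // h.
  + by have := h e; rewrite inE eqxx !ffunE (negPf Ye) => /(_ isT)/esym/eqP; rewrite (negPf Ye).
  + by have := h e; rewrite inE eqxx !ffunE (negPf Ye) => /(_ isT)/eqP; rewrite (negPf Ye).
  + congr comp_vec; apply: Cs => // f fs.
    by have := h f; rewrite inE fs orbT => /(_ isT); rewrite !ffunE Ys'.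
- rewrite cardsU1 card_in_imset // Cc; case: imsetP => // -[X XC /ffunP/(_ e)].
  by rewrite !ffunE (negPf Ye) => /esym/eqP; rewrite (negPf Ye).
Qed.

Lemma rank_ge s : free L s -> size s <= rank L.
Proof.
move=> /free_chain[C [CL Cch _ Cc]]; rewrite /rank.
by apply: (bigmax_sup C) => //; rewrite ?CL ?Cch ?Cc.
Qed.

(** Each strict step of the chain yields an element where the lower covector is zero and the upper
    one is not. It is independent of the elements found higher up, because these all lie in the zero
    set of the upper covector. *)
Lemma chain_free C : C \subset L -> is_chain C -> C != set0 ->
  exists2 X, X \in C & exists s, [/\ free L s, [set:: s] \subset zero_set X,
     size s = #|C|.-1 & {in C, forall Y, le_vec X Y}].
Proof.
elim: {C}_.+1 {-2}C (ltnSn #|C|) => // m IH C hC CL Cch /set0Pn[X0 X0C].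
(* In a chain, the covector with the largest zero set is the least one. *)
case: (arg_maxnP (fun Y => #|zero_set Y|) X0C) => X /= XC Xmax; have {}XC : X \in C by [].
have Xmin Y : Y \in C -> le_vec X Y.
  move=> YC; have /orP[//|YX] := chainP _ Cch _ _ XC YC.
  have [->|/eqP hXY] := eqVneq Y X; first exact: le_vec_refl.
  have [f Yf Xf] := le_vec_neq YX hXY.
  suff hlt : #|zero_set X| < #|zero_set Y| by have := Xmax Y YC; rewrite /= leqNgt hlt.
  apply: proper_card; apply/properP; split; last by exists f; rewrite inE ?Yf.
  by apply/subsetP => g; rewrite !inE => /eqP/(le_vec_zero YX)->.
have [C0|C0] := eqVneq (C :\ X) set0.
  exists X => //; exists [::]; split=> //; first by rewrite set_nil sub0set.
  by rewrite (cardsD1 X) XC C0 cards0.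
have [||||X1] := IH (C :\ X); rewrite ?C0 //.
- by move: hC; rewrite (cardsD1 X C) XC add1n ltnS.
- exact: subset_trans (subD1set _ _) CL.
- by apply/chainP => Y Z /setD1P[_ YC] /setD1P[_ ZC]; apply: (chainP _ Cch).
case/setD1P => X1X X1C [s [fs sX1 ss _]]; exists X => //.
have [e Xe X1e] : exists2 e, X e = Zero & X1 e != Zero.
  by apply: le_vec_neq; [exact: Xmin | apply/nesym/eqP].
exists (e :: s); split=> //=.
- rewrite fs andbT; apply/spanP => h; move: X1e; rewrite h ?eqxx ?(subsetP CL) // => f.
  by move=> /(subsetP sX1); rewrite inE => /eqP.
- rewrite set_cons subUset sub1set inE Xe eqxx (subset_trans sX1) //.
  by apply/subsetP => f; rewrite !inE => /eqP/(le_vec_zero (Xmin _ X1C))->.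
- by rewrite /= ss (cardsD1 X C) XC add1n prednK // card_gt0.
Qed.

Lemma rank_basis s : free L s -> span L [set:: s] = setT -> rank L = size s.
Proof.
move=> fs sT; apply/eqP; rewrite eqn_leq rank_ge // andbT.
apply/bigmax_leqP => C /andP[CL Cch].
have [->|C0] := eqVneq C set0; first by rewrite cards0.
have [X XC [t [ft _ <- _]]] := chain_free CL Cch C0.
apply: leq_trans (steinitz hL ft (B := [set:: s]) _) _; first by rewrite sT.
by rewrite cardsE; apply: card_size.
Qed.

End Rank.

(** * Relabelling, reorientation and parallel copies *)

Section Pull.
Variables (E E' : finType) (g : E' -> E) (r : E' -> bool).
Implicit Types (X Y : signvec E) (L : {set signvec E}).

(** One construction for several operations: restriction ([g] an inclusion), reorientation ([g] the
    identity), and replacing elements by parallel copies ([g] surjective). *)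
Definition pull X : signvec E' :=
  [ffun e => if r e then opp_sign (X (g e)) else X (g e)].

Lemma pull_eq0 X e : (pull X e == Zero) = (X (g e) == Zero).
Proof. by rewrite ffunE; case: (r e); rewrite ?opp_sign_eq0. Qed.

Lemma pull_comp X Y : pull (comp_vec X Y) = comp_vec (pull X) (pull Y).
Proof.
by apply/ffunP => e; rewrite !ffunE; case: (r e) => //; case: (X _).
Qed.

Lemma pull_opposite X Y e :
  opposite (pull X e) (pull Y e) = opposite (X (g e)) (Y (g e)).
Proof. by rewrite !ffunE; case: (r e) => //; case: (X _) (Y _) => [] []. Qed.

Lemma pull_om L : oriented_matroid L -> oriented_matroid (pull @: L).
Proof.
move=> hL; split.
- apply/imsetP; exists (zero_vec E); first exact: om_zero.
  by apply/ffunP => e; rewrite !ffunE /= if_same.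
- move=> _ /imsetP[X XL ->]; apply/imsetP; exists (opp_vec X); first exact: om_opp.
  by apply/ffunP => e; rewrite !ffunE; case: (r e).
- move=> _ _ /imsetP[X XL ->] /imsetP[Y YL ->]; rewrite -pull_comp.
  by rewrite imset_f // om_comp.
move=> _ _ e /imsetP[X XL ->] /imsetP[Y YL ->].
rewrite inE -[_ && _]/(opposite _ _) pull_opposite => hop.
have [Z ZL [Ze hZ]] := om_elim hL XL YL hop.
exists (pull Z); first exact: imset_f.
split=> [|f]; first by apply/eqP; rewrite pull_eq0 Ze.
rewrite inE -[_ && _]/(opposite _ _) pull_opposite -pull_comp ![pull _ f]ffunE => /hZ->.
by rewrite [comp_vec X Y _]ffunE.
Qed.

Lemma pull_span L (A : {set E'}) e :
  (e \in span (pull @: L) A) = (g e \in span L (g @: A)).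
Proof.
apply/spanP/spanP => h X.
  move=> XL hX; apply/eqP; rewrite -pull_eq0 h ?imset_f // => f fA.
  by apply/eqP; rewrite pull_eq0 hX ?imset_f.
case/imsetP => {}X XL -> hX; apply/eqP; rewrite pull_eq0 h // => _ /imsetP[f fA ->].
by apply/eqP; rewrite -pull_eq0 hX.
Qed.

Lemma pull_free L (s : seq E') : free (pull @: L) s = free L (map g s).
Proof.
elim: s => [//|e s IH]; rewrite map_cons !free_cons IH; congr (~~ _ && _).
rewrite [LHS]pull_span; congr (_ \in span L _).
apply/setP => f; rewrite inE; apply/imsetP/mapP => [[x]|[x xs ->]].
  by rewrite inE => xs ->; exists x.
by exists x; rewrite ?inE.
Qed.

End Pull.

Section Restrict.
Variables (E : finType) (L : {set signvec E}) (A : {set E}).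

Lemma restrictE : restrict L A = pull val (fun=> false) @: L.
Proof. by apply: eq_imset => X; apply/ffunP => e; rewrite !ffunE. Qed.

Hypothesis hL : oriented_matroid L.

Lemma restrict_om : oriented_matroid (restrict L A).
Proof. by rewrite restrictE; apply: pull_om. Qed.

Lemma flat_rank_basis (s : seq E) : free L s -> {subset s <= A} ->
  A \subset span L [set:: s] -> flat_rank L A = size s.
Proof.
move=> fs sA As; pose t : seq {x | x \in A} := pmap insub s.
have ts : map val t = s.
  rewrite /t pmap_filter; last by move=> x /=; rewrite insubK.
  by apply/all_filterP/allP => x /sA xA; rewrite /= insubT.
rewrite -ts size_map; apply: rank_basis; first exact: restrict_om.
  by rewrite restrictE pull_free ts.
apply/setP => e; rewrite in_setT restrictE pull_span.
have -> : val @: [set:: t] = [set:: s].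
  apply/setP => f; rewrite -ts inE; apply/imsetP/mapP => [[x]|[x xs ->]].
    by rewrite inE => xs ->; exists x.
  by exists x; rewrite ?inE.
exact: (subsetP As _ (valP e)).
Qed.

End Restrict.

(** * Modular hyperplanes and lines *)

Section Modular.
Variables (E : finType) (L : {set signvec E}).
Hypothesis hL : oriented_matroid L.
Implicit Types (X Y Z : signvec E) (F G : {set E}) (s t : seq E).

Definition lines_meet F : Prop :=
  forall i j, i \notin F -> j \notin F -> i != j ->
    exists2 z, z \in F & z \in span L [set i; j].

Definition loopless : Prop := forall e, e \notin span L set0.

Lemma simple_loopless : simple_om L -> loopless.
Proof.
case=> h _ e; apply/negP => /spanP he; apply: (h e) => X XL.
by apply: he => // f; rewrite inE.
Qed.

Lemma span1_sym i j :
  i \notin span L set0 -> i \in span L [set j] -> j \in span L [set i].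
Proof.
move=> h hi; rewrite -[[set i]]setU0; apply: span_exchange => //.
by rewrite setU0.
Qed.

(** Zeros at i and j coincide. If X and Y were nonzero there, with X opposite and Y equal at the two
    places, then eliminating i between Y and X or its opposite would leave j nonzero. *)
Lemma span1_parallel i j :
  i \notin span L set0 -> i \in span L [set j] -> parallel L i j.
Proof.
move=> hl hij; have /spanP hji := span1_sym hl hij; move/spanP: hij => hij.
have zij X : X \in L -> (X i == Zero) = (X j == Zero).
  move=> XL; apply/eqP/eqP => h; [apply: hji|apply: hij] => // f /set1P->//.
have [/forall_inP h|/forall_inPn[X XL hX]] := boolP [forall X in L, X i == X j].
  by left=> X /h/eqP.
right=> Y YL; apply/eqP/negPn/negP => hY.
have key U : U \in L -> U i = opp_sign (U j) -> U i != Zero -> opposite (U i) (Y i) -> False.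
  move=> UL Uij Ui hop; have [Z ZL [Zi hZ]] := om_elim hL UL YL hop.
  have := zij _ ZL; rewrite Zi eqxx hZ; have := zij _ YL.
    by move: Uij Ui hY hop; case: (U i) (U j) (Y i) (Y j) => [] [] [] [].
  by move=> ?; move: Uij Ui hY hop; case: (U i) (U j) (Y i) (Y j) => [] [] [] [].
have hXo : X i = opp_sign (X j) /\ X i != Zero.
  by have := zij _ XL; move: hX; case: (X i) (X j) => [] [].
case: hXo => Xij Xi.
have [hop|hop] := boolP (opposite (X i) (Y i)); first exact: (key X).
apply: (key (opp_vec X)); rewrite ?om_opp // !ffunE.
- by rewrite Xij.
- by rewrite opp_sign_eq0.
- have := zij _ YL; move: hop Xi hY; case: (X i) (Y i) (Y j) => [] [] [] //.
Qed.

Lemma simple_span1 i j : simple_om L -> i \in span L [set j] -> i = j.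
Proof.
move=> hs hij; apply/eqP/negPn/negP => ne; case: (hs) => _ /(_ _ _ ne); apply.
exact/span1_parallel/hij/simple_loopless.
Qed.

Lemma flat_span_subset F G : flat L F -> G \subset F -> span L G \subset F.
Proof. by move=> /flat_closed {2}<-; apply: spanS. Qed.

Lemma span_eqT A : (span L A == setT) = (setT \subset span L A).
Proof. by rewrite -subTset. Qed.

(** A basis of F with i added already has as many elements as the rank, so its completion [u] to a
    basis is empty. *)
Lemma hyperplane_span F i : hyperplane L F -> i \notin F -> span L (i |: F) = setT.
Proof.
case=> hF hr iF; have [s sF [fs Fs]] := basis_exists L F.
have fis : free L (i :: s).
  rewrite free_cons fs andbT; apply: contra iF; apply/subsetP/flat_span_subset => //.
  by apply/subsetP => e; rewrite inE => /sF.
have [u _ [fu uT]] := @free_extend _ L (i :: s) (enum E) fis.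
have uT' : span L [set:: u ++ i :: s] = setT.
  apply/eqP; rewrite span_eqT (subset_trans _ uT) //.
  by apply/subsetP => e; rewrite inE mem_enum.
have := rank_basis hL fu uT'; rewrite -hr (flat_rank_basis hL fs sF Fs) size_cat /= => hsz.
have u0 : u = [::] by apply/size0nil/(@addIn (size s).+1).
rewrite u0 /= in uT'; apply/eqP; rewrite span_eqT -uT' spanS // set_cons.
by rewrite setUS //; apply/subsetP => e; rewrite inE => /sF.
Qed.

Lemma flat_rank_setT : flat_rank L setT = rank L.
Proof.
have [s _ [fs Ts]] := basis_exists L setT.
have -> : flat_rank L setT = size s by apply: flat_rank_basis => // e; rewrite in_setT.
by symmetry; apply: rank_basis => //; apply/eqP; rewrite span_eqT.
Qed.

(** The line G has rank 2 and its join with F is everything, so modularity leaves rank 1 for the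
    meet, which is therefore not empty. *)
Lemma modular_lines F : simple_om L -> modular_hyperplane L F -> lines_meet F.
Proof.
move=> hs [hF [fF hmod]] i j iF jF ij.
have hl := simple_loopless hs.
pose G := span L [set i; j].
have iG : i \in G by apply: mem_span; rewrite !inE eqxx.
have rG : flat_rank L G = 2.
  apply: (@flat_rank_basis _ L G hL [:: i; j]).
  - rewrite !free_cons /= set_nil (hl j) !andbT.
    by apply: contra ij => h; apply/eqP/simple_span1; rewrite // set_cons set_nil setU0 in h.
  - by move=> e; rewrite in_cons mem_seq1 => /orP[] /eqP->; apply: mem_span; rewrite !inE eqxx ?orbT.
  - by rewrite span_trans // set_cons set_cons set_nil setU0 sub_span.
have jT : flat_join L F G = setT.
  rewrite span_join; apply/eqP; rewrite span_eqT -(hyperplane_span hF iF) spanS //.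
  by rewrite setUC setUS // sub1set.
have := hmod G (span_flat hL _); rewrite jT rG flat_rank_setT -(proj2 hF) => h.
have [h0|[z]] := set_0Vmem (F :&: G); last by rewrite inE => /andP[zF zG]; exists z.
move: h; rewrite /flat_meet h0 (@flat_rank_basis _ L set0 hL [::]) ?sub0set //=; lia.
Qed.

Section Lines.
Variable F : {set E}.
Hypotheses (hl : loopless) (fF : flat L F) (hF : lines_meet F).

(** For j in G outside F, the line through i and j meets F in a point z of G, and j lies on the line
    through i and z. So F lowers the rank of G by exactly one. *)
Lemma basis_cons G i s : flat L G -> i \in G -> i \notin F -> free L s ->
  {subset s <= F :&: G} -> F :&: G \subset span L [set:: s] ->
  [/\ free L (i :: s), {subset i :: s <= G} & G \subset span L [set:: i :: s]].
Proof.
move=> fG iG iF fs sFG FGs; split.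
- rewrite free_cons fs andbT; apply: contra iF; apply/subsetP/flat_span_subset => //.
  by apply/subsetP => e; rewrite inE => /sFG/setIP[].
- by move=> e; rewrite inE => /orP[/eqP->//|/sFG/setIP[]].
apply/subsetP => j jG; have [->|ji] := eqVneq j i.
  by apply: mem_span; rewrite !inE eqxx.
have sub : [set:: s] \subset [set:: i :: s] by rewrite set_cons subsetUr.
have [jF|jF] := boolP (j \in F).
  by apply: (subsetP (spanS L sub)); apply: (subsetP FGs); rewrite inE jF.
have ij : i != j by rewrite eq_sym.
have [z zF zij] := hF iF jF ij.
have zG : z \in G.
  apply: (subsetP (flat_span_subset fG _) z zij).
  by apply/subsetP => e; rewrite !inE => /orP[] /eqP->.
have zi : z \notin span L [set i].
  apply: contra iF => /(span1_sym (hl z)); apply/subsetP/flat_span_subset => //.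
  by rewrite sub1set.
have /(span_exchange hL)/(_ zi) : z \in span L (j |: [set i]) by rewrite setUC.
apply: (subsetP (span_trans _)); rewrite subUset !sub1set; apply/andP; split.
  apply: (subsetP (spanS L sub)); apply: (subsetP FGs); rewrite inE zF //.
by apply: mem_span; rewrite !inE eqxx.
Qed.

(** By [basis_cons], meeting with F lowers by one the rank of every flat not inside F. For the whole
    ground set this says that F is a hyperplane; compared with another such flat it is the modular
    equation. *)
Lemma lines_modular : F != setT -> modular_hyperplane L F.
Proof.
move=> FT; have [i iF] : exists i, i \notin F.
  apply/existsP; apply: contraR FT => /existsPn h; apply/eqP/setP => e.
  by rewrite inE; apply/negPn/h.
have fT : flat L setT.
  apply/exists_inP; exists (zero_vec E); first exact: om_zero.
  by apply/eqP/setP => e; rewrite !inE ffunE eqxx.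
have [s sF [fs Fs]] := basis_exists L F.
have [] := @basis_cons setT i s fT; rewrite ?inE ?setIT // => fis siT Tis.
have rF := flat_rank_basis hL fs sF Fs.
have rT : flat_rank L setT = (size s).+1 by rewrite (flat_rank_basis hL fis siT Tis).
split; first split=> //.
  by rewrite rF (rank_basis hL fis) //; apply/eqP; rewrite span_eqT.
split=> // G fG.
have [GF|/subsetPn[j jG jF]] := boolP (G \subset F).
  rewrite span_join /flat_meet (setIidPr GF) (setUidPl GF) (flat_closed fF); lia.
have [t tFG [ft FGt]] := basis_exists L (F :&: G).
have [fjt jtG Gjt] := basis_cons fG jG jF ft tFG FGt.
have [] := @basis_cons setT j s fT; rewrite ?inE ?setIT // => fjs sjT Tjs.
have -> : flat_join L F G = setT.
  apply/eqP; rewrite span_join span_eqT (subset_trans Tjs) // spanS //.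
  rewrite set_cons subUset sub1set inE jG orbT /=.
  by apply/subsetP => e; rewrite !inE => /sF->.
rewrite rT rF (flat_rank_basis hL fjt jtG Gjt) /= /flat_meet.
by rewrite (flat_rank_basis hL ft tFG FGt) addnS addnC -addnS.
Qed.

End Lines.
End Modular.

(** * Ordered partitions as sign vectors on pairs *)

Definition cmp (m k : nat) : sign :=
  if m < k then Pos else if k < m then Neg else Zero.

(* [tri a b c]: the signs [a], [b], [c] are those of [x], [y], [y - x] for
   some reals [x] and [y]. *)
Definition tri (a b c : sign) : bool :=
  match a, b with
  | Neg, Neg | Pos, Pos => true
  | Zero, _ => c == b
  | Neg, _ => c == Pos
  | Pos, _ => c == Neg
  end.

Lemma tri_comp a b c a' b' c' : tri a b c -> tri a' b' c' ->
  tri (comp_sign a a') (comp_sign b b') (comp_sign c c').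
Proof. by case: a b c => [] [] [] // _; case: a' b' c' => [] [] []. Qed.

Lemma tri_opp a b c : tri (opp_sign a) (opp_sign b) (opp_sign c) = tri a b c.
Proof. by case: a b c => [] [] []. Qed.

Lemma tri_sym a b c : tri b a (opp_sign c) = tri a b c.
Proof. by case: a b c => [] [] []. Qed.

(** The hypotheses force the two composed signs to be equal and nonzero, and then every sign of the
    difference is possible. *)
Lemma tri_opposite a b c a' b' c' d : tri a b c -> tri a' b' c' ->
  ~~ opposite a a' -> ~~ opposite b b' -> opposite c c' ->
  tri (comp_sign a a') (comp_sign b b') d.
Proof. by case: a b c => [] [] [] // _; case: a' b' c' => [] [] []; case: d. Qed.

Section Delta.
Variable n : nat.
Implicit Types (X Y Z : signvec (ipair n)) (i j k : 'I_n).

(** The antisymmetric extension of X from pairs i < j to all pairs of indices, which spares case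
    distinctions on their order. *)
Definition delta X i j : sign :=
  if insub (i, j) is Some p then X (p : {p : 'I_n * 'I_n | p.1 < p.2})
  else if insub (j, i) is Some p then opp_sign (X (p : {p : 'I_n * 'I_n | p.1 < p.2}))
  else Zero.

Lemma delta_cases i j : [\/ i = j /\ (forall X, delta X i j = Zero),
  exists2 p : ipair n, val p = (i, j) & forall X, delta X i j = X p |
  exists2 p : ipair n, val p = (j, i) & forall X, delta X i j = opp_sign (X p)].
Proof.
have [ij|ji|/val_inj ij] := ltngtP i j.
- apply: Or32; exists (exist _ (i, j) ij) => // X; rewrite /delta.
  by rewrite insubT.
- apply: Or33; exists (exist _ (j, i) ji) => // X; rewrite /delta.
  by rewrite insubF ?insubT //= ltnNge ltnW.
- by apply: Or31; split=> // X; rewrite /delta ij insubF /= ?ltnn.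
Qed.

Lemma delta_pair X (p : ipair n) : delta X (val p).1 (val p).2 = X p.
Proof.
rewrite /delta -surjective_pairing (_ : insub (val p) = Some p) //; exact: valK.
Qed.

Lemma delta_inj X Y : (forall i j, delta X i j = delta Y i j) -> X = Y.
Proof. by move=> h; apply/ffunP => p; rewrite -!delta_pair. Qed.

Lemma delta_refl X i : delta X i i = Zero.
Proof.
have [[_ ->]//|[p hp _]|[p hp _]] := delta_cases i i;
by have := valP p; rewrite hp ltnn.
Qed.

Lemma delta_sym X i j : delta X j i = opp_sign (delta X i j).
Proof.
case: (delta_cases i j) => [[-> _]|[p hp ->]|[p hp ->]]; first by rewrite delta_refl.
  have ij : i < j by have := valP p; rewrite hp.
  have ji : (j < i) = false by rewrite ltnNge ltnW.
  have := delta_pair X p; rewrite hp /= => <-.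
  by rewrite /delta (@insubF _ _ _ (j, i)) // insubT.
by have := delta_pair X p; rewrite hp /= opp_signK.
Qed.

Lemma delta_opp X i j : delta (opp_vec X) i j = opp_sign (delta X i j).
Proof. by case: (delta_cases i j) => [[_ h]|[p _ h]|[p _ h]]; rewrite !h ?ffunE. Qed.

Lemma delta_comp X Y i j :
  delta (comp_vec X Y) i j = comp_sign (delta X i j) (delta Y i j).
Proof.
by case: (delta_cases i j) => [[_ h]|[p _ h]|[p _ h]]; rewrite !h ?ffunE //;
case: (X p).
Qed.

Lemma delta_zero i j : delta (zero_vec _) i j = Zero.
Proof. by case: (delta_cases i j) => [[_ h]|[p _ h]|[p _ h]]; rewrite !h ?ffunE. Qed.

Lemma delta_elim (M : {set signvec (ipair n)}) X Y i j :
  oriented_matroid M -> X \in M -> Y \in M ->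
  opposite (delta X i j) (delta Y i j) ->
  exists2 Z, Z \in M & delta Z i j = Zero /\
    forall k l, ~~ opposite (delta X k l) (delta Y k l) ->
      delta Z k l = comp_sign (delta X k l) (delta Y k l).
Proof.
move=> hM XM YM hop.
have [p hp hij] : exists2 p : ipair n, opposite (X p) (Y p) &
    forall Z, Z p = Zero -> delta Z i j = Zero.
  move: hop; case: (delta_cases i j) => [[_ h]|[p _ h]|[p _ h]]; rewrite !h //.
    by exists p => // Z; rewrite h.
  move=> hp; exists p; last by move=> Z; rewrite h => ->.
  by move: hp; case: (X p) (Y p) => [] [].
have [Z ZM [Zp hZ]] := om_elim hM XM YM hp.
exists Z => //; split=> [|k l]; first exact: hij.
case: (delta_cases k l) => [[_ h]|[q _ h]|[q _ h]]; rewrite !h // => hq.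
  exact: hZ.
by rewrite hZ; move: hq; case: (X q) (Y q) => [] [].
Qed.

Lemma delta_sweep I i j :
  delta (sweep_covector I) i j = cmp (block_index I i) (block_index I j).
Proof.
case: (delta_cases i j) => [[-> ->]|[p hp ->]|[p hp ->]].
- by rewrite /cmp ltnn.
- by rewrite ffunE hp.
- by rewrite ffunE hp /= /cmp; case: ltngtP.
Qed.

Lemma block_index_le (I : seq {set 'I_n}) i : ordered_partition I -> block_index I i <= size I.
Proof.
case/andP => _ /and3P[/eqP/setP/(_ i) hI _ _]; move: hI; rewrite inE => /bigcupP[B].
by rewrite inE => BI iB; rewrite /block_index -has_find; apply/hasP; exists B.
Qed.

Lemma size_ordered_partition (I : seq {set 'I_n}) : ordered_partition I -> size I <= n.
Proof.
case/andP => uI pI; have := card_partition pI; rewrite cardsT card_ord => hn.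
have -> : size I = #|[set:: I]| by rewrite cardsE; apply/esym/card_uniqP.
rewrite [leqRHS]hn -sum1_card leq_sum // => B BI; rewrite card_gt0.
by case/and3P: pI => _ _; apply: contra => /eqP <-.
Qed.

Lemma ordered_partition_of (p : 'I_n -> nat) :
  exists2 I : seq {set 'I_n}, ordered_partition I &
    forall i j, cmp (block_index I i) (block_index I j) = cmp (p i) (p j).
Proof.
(* The blocks are the fibres of [p] over the values it takes, in increasing order; none is empty. *)
pose vs := sort leq (undup (map p (enum 'I_n))).
have vs_uniq : uniq vs by rewrite sort_uniq undup_uniq.
have mem_vs i : p i \in vs.
  by rewrite mem_sort mem_undup map_f ?mem_enum.
have vsP v : v \in vs -> exists i, p i = v.
  by rewrite mem_sort mem_undup => /mapP[i _ ->]; exists i.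
have vs_sorted : sorted ltn vs.
  by rewrite ltn_sorted_uniq_leq vs_uniq sort_sorted //; apply: leq_total.
pose fib v := [set i | p i == v].
have fib_inj : {in vs &, injective fib}.
  move=> v w /vsP[i <-] _ /setP/(_ i); rewrite !inE eqxx.
  by move=> /esym/eqP.
exists (map fib vs).
  apply/andP; split; first by rewrite map_inj_in_uniq.
  apply/and3P; split.
  - apply/eqP/setP => i; rewrite [RHS]inE; apply/bigcupP; exists (fib (p i)).
      by rewrite inE map_f.
    by rewrite inE.
  - apply/trivIsetP => A B; rewrite !inE => /mapP[v _ ->] /mapP[w _ ->] ne.
    rewrite -setI_eq0; apply/eqP/setP => i; rewrite !inE.
    by apply: contraNF ne => /andP[/eqP-> /eqP->].
  - rewrite inE; apply/mapP => -[v /vsP[i <-] /setP/(_ i)]; rewrite !inE eqxx //.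
have bi i : block_index (map fib vs) i = (index (p i) vs).+1.
  rewrite /block_index find_map /index; congr _.+1; apply: eq_find => v /=.
  by rewrite inE eq_sym.
move=> i j; rewrite !bi /cmp !ltnS.
have idx k l : (index (p k) vs < index (p l) vs) = (p k < p l).
  have lt_idx := sorted_ltn_index ltn_trans vs_sorted.
  apply/idP/idP; first exact: lt_idx.
  apply: contraTT; rewrite -!leqNgt leq_eqVlt => /predU1P[h|]; last by move/lt_idx/ltnW; apply.
  by rewrite -(nth_index 0 (mem_vs k)) -(nth_index 0 (mem_vs l)) h.
by rewrite !idx.
Qed.

End Delta.

(** * Elimination in the big oriented matroid *)

Section BigOM.
Variables (n : nat) (M : {set signvec (ipair n)}).
Hypothesis hM : sweep_oriented_matroid M.
Implicit Types (X Y Z W : signvec (ipair n)) (U V : signvec ('I_n + ipair n)%type).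
Implicit Types (i j k : 'I_n).

Definition pair_part U : signvec (ipair n) := [ffun p => U (inr p)].

Definition big_compatible U : Prop :=
  forall i j, tri (U (inl i)) (U (inl j)) (delta (pair_part U) i j).

(** Here [u] and [v] stand for the two rounded halves in [big_covector]. As they differ by at most
    one, at most one block receives the sign 0. *)
Lemma tri_cut (u v m k : nat) : u <= v <= u.+1 ->
  tri (if m <= u then Neg else if v < m then Pos else Zero)
      (if k <= u then Neg else if v < k then Pos else Zero) (cmp m k).
Proof.
move=> huv; rewrite /cmp.
case: (leqP m u) => hm; case: (leqP k u) => hk //=; try case: (ltnP v m) => hm';
  try case: (ltnP v k) => hk' //=; case: (ltngtP m k) => //=; lia.
Qed.

Lemma cut_exists (l : nat) (b : 'I_n -> nat) (c : 'I_n -> sign) :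
  (forall i, 0 < b i <= l) ->
  (forall i j, tri (c i) (c j) (cmp (b i) (b j))) ->
  exists2 k : nat, 0 < k < (2 * l).+2 & forall i, c i =
    if b i <= k.-1./2 then Neg else if k./2 < b i then Pos else Zero.
Proof.
move=> hb hc.
have [/existsP[i0 /eqP ci0]|/existsPn nz] := boolP [exists i, c i == Zero].
  (* An even cut number puts exactly the block [b i0] at zero. *)
  have hb0 := hb i0; exists (2 * b i0); first lia.
  rewrite mul2n doubleK; have -> : (b i0).*2.-1./2 = (b i0).-1.
    by case: (b i0) => // m; rewrite doubleS /= uphalf_double.
  move=> j; have := hc i0 j; rewrite ci0 /= => /eqP <-; rewrite /cmp.
  case: (ltngtP (b i0) (b j)) => hlt; case: leqP => h2 //; try lia.
have [/existsP[i1 hi1]|/existsPn nn] := boolP [exists i, c i == Neg]; last first.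
  (* With no zero and no negative sign, the cut precedes all blocks. *)
  exists 1 => // j; have := hb j; have := nz j; have := nn j.
  by case: (c j) => //= _ _; case: (b j).
case: (@arg_maxnP _ i1 (fun i => c i == Neg) b hi1) => i0 /= /eqP ci0 hmax.
(* An odd cut number puts the cut just after the last block containing a negative index. *)
have hb0 := hb i0; exists (2 * b i0).+1; first lia.
rewrite mul2n /= uphalf_double doubleK.
move=> j; case: leqP => hj.
  have := hc i0 j; rewrite ci0 /cmp ltnNge hj /=.
  by case: ifP; case: (c j).
have := nz j; case E : (c j) => // _.
by have := hmax j; rewrite E eqxx => /(_ isT); rewrite leqNgt hj.
Qed.

(** Replaces the global cut number by a local sign condition on i, j and their pair, the form in
    which the covector axioms can be checked. *)
Lemma big_omP U : reflect (pair_part U \in M /\ big_compatible U) (U \in big_om M).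
Proof.
rewrite inE; apply: (iffP idP).
  case/existsP => l /existsP[I /existsP[k /and4P[hI IM k0 /eqP->]]].
  have hp : pair_part (big_covector I k) = sweep_covector I.
    by apply/ffunP => p; rewrite !ffunE.
  rewrite hp; split=> // i j; rewrite hp delta_sweep !ffunE; apply: tri_cut.
  by move: k0; case: (nat_of_ord k) => // m _ /=; rewrite uphalf_half; case: odd; rewrite ?leqnn ?leqnSn.
case=> UM hU; have [I hI hUI] := proj2 hM _ UM.
have [i|i j|k hk hc] := @cut_exists (size I) (block_index I) (fun i => U (inl i)).
- by rewrite block_index_le.
- by have := hU i j; rewrite hUI delta_sweep.
have hs : size I < n.+1 by rewrite ltnS size_ordered_partition.
apply/existsP; exists (Ordinal hs); apply/existsP; exists (in_tuple I).
case/andP: hk => k0 hk; apply/existsP; exists (Ordinal hk).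
rewrite hI -hUI UM k0 /=; apply/eqP/ffunP => -[i|p]; rewrite ffunE ?hc //.
by rewrite -hUI ffunE.
Qed.

(** An index is negative if forced so by a negative index in the same or a later block or by a zero
    index in a later block, zero if it shares a block with a zero index, and positive by default. *)
Lemma big_extend Z (D : pred 'I_n) (c : 'I_n -> sign) : Z \in M ->
  (forall i j, D i -> D j -> tri (c i) (c j) (delta Z i j)) ->
  exists2 U, U \in big_om M & pair_part U = Z /\ forall i, D i -> U (inl i) = c i.
Proof.
move=> ZM hc; have [I hI hZI] := proj2 hM _ ZM.
pose b := block_index I.
have {}hc i j : D i -> D j -> tri (c i) (c j) (cmp (b i) (b j)).
  by move=> Di Dj; have := hc _ _ Di Dj; rewrite hZI delta_sweep.
pose neg j := [exists i, D i && ((c i == Neg) && (b j <= b i) || (c i == Zero) && (b j < b i))].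
pose zer j := [exists i, D i && ((c i == Zero) && (b j == b i))].
pose d j := if neg j then Neg else if zer j then Zero else Pos.
exists [ffun e => match e with inl i => d i | inr p => Z p end].
  have hp : pair_part [ffun e => match e with inl i => d i | inr p => Z p end] = Z.
    by apply/ffunP => p; rewrite !ffunE.
  apply/big_omP; rewrite /big_compatible hp; split=> // i j; rewrite !ffunE hZI delta_sweep -/b.
  have key i' j' : b i' < b j' -> d j' != Pos -> d i' = Neg.
    move=> hij hj; rewrite /d; suff -> : neg i' by [].
    move: hj; rewrite /d /neg /zer; case: ifP => [/existsP[k /andP[Dk hk]] _|_].
      apply/existsP; exists k; rewrite Dk /=.
      case/orP: hk => /andP[-> h] /=; first by rewrite (leq_trans (ltnW hij) h).
      by rewrite (ltn_trans hij h) orbT.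
    case: ifP => // /existsP[k /and3P[Dk ck /eqP bk]] _.
    by apply/existsP; exists k; rewrite Dk ck -bk hij orbT.
  rewrite /cmp; case: ltngtP => hij.
  - by have := key _ _ hij; case: (d j) => [||_]; [move=> ->|move=> ->|case: (d i)].
  - by have := key _ _ hij; case: (d i) => [||_]; [move=> ->|move=> ->|case: (d j)].
  - by rewrite /d /neg /zer hij; case: ifP => // _; case: ifP.
split=> [|i Di]; first by apply/ffunP => p; rewrite !ffunE.
rewrite ffunE /d /neg /zer; case: ifP => [/existsP[k /andP[Dk]]|/existsPn hn].
  have := hc i k Di Dk; rewrite /cmp => ht /orP[] /andP[/eqP ck hk]; move: ht; rewrite ck.
    by move: hk; case: ltngtP => //; case: (c i).
  by rewrite hk; case: (c i).
case: ifP => [/existsP[k /and3P[Dk /eqP ck /eqP hk]]|/existsPn hz].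
  by have := hc i k Di Dk; rewrite /cmp ck hk ltnn; case: (c i).
have := hn i; have := hz i; rewrite Di eqxx leqnn.
by case: (c i).
Qed.


Lemma pair_part_opp U : pair_part (opp_vec U) = opp_vec (pair_part U).
Proof. by apply/ffunP => p; rewrite !ffunE. Qed.

Lemma pair_part_comp U V : pair_part (comp_vec U V) = comp_vec (pair_part U) (pair_part V).
Proof. by apply/ffunP => p; rewrite !ffunE. Qed.

Lemma sweep_trans X i j k : X \in M -> delta X i j = Zero -> delta X i k = delta X j k.
Proof.
case/(proj2 hM) => I _ ->; rewrite !delta_sweep /cmp.
by case: ltngtP => // ->.
Qed.

Let hM' := proj1 hM.

(** * Lifting an elimination from the pairs to the indices *)

Section Elimination.
Variables (U V : signvec ('I_n + ipair n)%type).
Hypotheses (UB : U \in big_om M) (VB : V \in big_om M).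
Let X := pair_part U.
Let Y := pair_part V.
Let u i : sign := U (inl i).
Let v i : sign := V (inl i).
Let c i := comp_sign (u i) (v i).

Let XM : X \in M. Proof. by case/big_omP: UB. Qed.
Let YM : Y \in M. Proof. by case/big_omP: VB. Qed.
Let triX i j : tri (u i) (u j) (delta X i j). Proof. by case/big_omP: UB => _; apply. Qed.
Let triY i j : tri (v i) (v j) (delta Y i j). Proof. by case/big_omP: VB => _; apply. Qed.

(** No zero is demanded: the composition of X and Y qualifies, and the property survives further
    compositions with Y and eliminations against it, so Z can be improved in stages. *)
Definition eliminates Z : Prop := Z \in M /\ forall i j,
  ~~ opposite (delta X i j) (delta Y i j) -> delta Z i j = comp_sign (delta X i j) (delta Y i j).

(** [D] collects the indices with a prescribed sign: the composed one if U and V are not opposite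
    there, and zero for at most one separated index. Where the difference of two unseparated indices
    is itself separated, [tri_opposite] makes any sign of Z acceptable. *)
Lemma eliminates_lift Z (D : pred 'I_n) :
  eliminates Z -> (forall i, ~~ opposite (u i) (v i) -> D i) ->
  (forall i, D i -> opposite (u i) (v i) ->
     forall j, ~~ opposite (u j) (v j) -> delta Z i j = c j) ->
  (forall i j, D i -> D j -> opposite (u i) (v i) -> opposite (u j) (v j) -> i = j) ->
  exists2 W : signvec ('I_n + ipair n)%type, W \in big_om M &
    (forall i, D i -> opposite (u i) (v i) -> W (inl i) = Zero) /\
    (forall e, ~~ opposite (U e) (V e) -> W e = comp_sign (U e) (V e)) /\
    pair_part W = Z.
Proof.
move=> [ZM hZ] hD hZero hsep.
pose d i := if opposite (u i) (v i) then Zero else c i.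
have [i j Di Dj|W WB [hW dW]] := @big_extend Z D d ZM.
  rewrite /d; case: ifPn => hi; case: ifPn => hj.
  - by rewrite (hsep i j) // delta_refl.
  - by rewrite hZero //= eqxx.
  - by rewrite -tri_sym -delta_sym hZero //= eqxx.
  have [hop|hop] := boolP (opposite (delta X i j) (delta Y i j)).
    exact: tri_opposite (triX i j) (triY i j) hi hj hop.
  by rewrite hZ //; apply: tri_comp.
exists W => //; split=> [i Di hi|]; first by rewrite dW // /d hi.
split=> // -[i|p] he; first by rewrite dW ?hD // /d ifN.
have := hZ (val p).1 (val p).2; rewrite !delta_pair -hW !ffunE; exact.
Qed.

Lemma eliminates_pair i j : opposite (delta X i j) (delta Y i j) ->
  exists2 Z, eliminates Z & delta Z i j = Zero.
Proof. by move=> /(delta_elim hM' XM YM)[Z ZM [Zij hZ]]; exists Z. Qed.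

Lemma eliminates_comp : eliminates (comp_vec X Y).
Proof. by split=> [|i j _]; rewrite ?om_comp // delta_comp. Qed.

Lemma eliminates_compr W : eliminates W -> eliminates (comp_vec W Y).
Proof.
move=> [WM hW]; split=> [|i j hij]; first exact: om_comp.
by rewrite delta_comp hW //; move: hij; case: (delta X i j) (delta Y i j) => [] [].
Qed.

Lemma eliminates_elim W i j : eliminates W -> opposite (delta W i j) (delta Y i j) ->
  exists2 Z, eliminates Z & delta Z i j = Zero /\
    forall k l, ~~ opposite (delta W k l) (delta Y k l) ->
      delta Z k l = comp_sign (delta W k l) (delta Y k l).
Proof.
move=> [WM hW] /(delta_elim hM' WM YM)[Z ZM [Zij hZ]].
exists Z; last by [].
split=> // k l hkl; have hWk := hW k l hkl.
by rewrite hZ hWk; move: hkl; case: (delta X k l) (delta Y k l) => [] [].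
Qed.

(* The position of [i0] relative to the negative elements is repaired one
   element at a time by eliminating against [Y]; each elimination puts [i0] in
   the block of a negative element, hence below every positive element. *)
Lemma eliminates_position i0 : u i0 = Neg -> v i0 = Pos ->
  exists2 Z, eliminates Z & forall j, ~~ opposite (u j) (v j) -> delta Z i0 j = c j.
Proof.
move=> u0 v0.
(* An index that must stay at zero dictates the position of [i0]: its own block. *)
have [/existsP[j0 /andP[hj0 /eqP cj0]]|/existsPn nz] :=
    boolP [exists j, ~~ opposite (u j) (v j) && (c j == Zero)].
  have [uj0 vj0] : u j0 = Zero /\ v j0 = Zero.
    by move: hj0 cj0; rewrite /c; case: (u j0) (v j0) => [] [].
  have [|Z ZE Z0] := @eliminates_pair i0 j0.
    have := triX i0 j0; have := triY i0 j0; rewrite u0 v0 uj0 vj0 /=.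
    by move=> /eqP-> /eqP->.
  exists Z => // j hj; rewrite (sweep_trans j (proj1 ZE) Z0).
  have := triX j0 j; have := triY j0 j; rewrite uj0 vj0 /= => /eqP hY /eqP hX.
  by rewrite (proj2 ZE) hX hY.
(* In the composition of X and Y, [i0] is already below all positive indices, as it is negative in
   U. *)
have [W WE] : exists2 W, eliminates W &
    forall j, ~~ opposite (u j) (v j) -> c j = Pos -> delta W i0 j = Pos.
  exists (comp_vec X Y) => [|j hj cj]; first exact: eliminates_comp.
  rewrite delta_comp; have := triX i0 j; rewrite u0.
  by move: hj cj; rewrite /c; case: (u j) (v j) => [] [] //= _ _ /eqP->.
(* The measure of the induction: the negative indices not yet strictly below [i0]. *)
pose bad W := [pred j | [&& ~~ opposite (u j) (v j), c j == Neg & delta W i0 j != Neg]].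
have yneg j : ~~ opposite (u j) (v j) -> c j = Neg -> delta Y i0 j = Neg.
  have := triY i0 j; rewrite v0 /c.
  by case: (u j) (v j) => [] [] //= /eqP.
elim: {W}_.+1 {-2}W (ltnSn #|bad W|) WE => // m IH W hm WE hpos.
have [/eqP b0|/pred0Pn[j1 /= /and3P[hj1 /eqP cj1 bj1]]] := boolP (#|bad W| == 0).
  exists W => // j hj; have := nz j; rewrite hj /=; case cj : (c j) => // _.
    by have := card0_eq b0 j; rewrite !inE hj cj /= => /negbFE/eqP.
  exact: hpos.
suff [Z ZE [Zpos Zj1 Zneg]] : exists2 Z, eliminates Z &
    [/\ forall j, ~~ opposite (u j) (v j) -> c j = Pos -> delta Z i0 j = Pos,
        delta Z i0 j1 = Neg &
        forall j, delta Y i0 j = Neg -> delta W i0 j = Neg -> delta Z i0 j = Neg].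
  apply: (IH Z) => //; apply: leq_trans (proper_card _) (hm : #|bad W| <= m).
  apply/properP; split; last by exists j1; rewrite !inE ?hj1 ?cj1 ?Zj1 ?bj1.
  apply/subsetP => j; rewrite !inE => /and3P[hj /eqP cj]; rewrite hj cj /=.
  by apply: contra => /eqP hWj; apply/eqP/Zneg => //; apply: yneg.
have Yj1 := yneg _ hj1 cj1.
case Wj1 : (delta W i0 j1) => //; first by rewrite Wj1 in bj1.
  exists (comp_vec W Y); first exact: eliminates_compr.
  split=> [j hj cj||j Yj Wj]; rewrite delta_comp; first by rewrite hpos.
    by rewrite Wj1 Yj1.
  by rewrite Wj.
have [|Z ZE [Z0 hZ]] := @eliminates_elim W i0 j1 WE; first by rewrite Wj1 Yj1.
exists (comp_vec Z Y); first exact: eliminates_compr.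
split=> [j hj cj||j Yj Wj]; rewrite delta_comp; last 2 first.
- by rewrite Z0 Yj1.
- by rewrite hZ ?Wj ?Yj.
rewrite (sweep_trans j (proj1 ZE) Z0) (proj2 ZE).
  have := triX j1 j; have := triY j1 j.
  move: hj cj hj1 cj1; rewrite /c.
  by case: (u j) (v j) (u j1) (v j1) => [] [] [] [] //= _ _ _ _ /eqP-> /eqP->.
have := triX j1 j; have := triY j1 j.
move: hj cj hj1 cj1; rewrite /c.
by case: (u j) (v j) (u j1) (v j1) => [] [] [] [] //= _ _ _ _ /eqP-> /eqP->.
Qed.

End Elimination.

Lemma eliminatesC U V Z : eliminates U V Z -> eliminates V U Z.
Proof.
case=> ZM hZ; split=> // i j; rewrite oppositeC => hij.
by rewrite hZ // comp_signC.
Qed.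

Lemma big_om_oriented : oriented_matroid (big_om M).
Proof.
split.
- have h0 : pair_part (zero_vec _) = zero_vec _ by apply/ffunP => p; rewrite !ffunE.
  by apply/big_omP; rewrite /big_compatible h0 om_zero //; split=> // i j;
    rewrite delta_zero !ffunE.
- move=> U /big_omP[UM hU]; apply/big_omP; rewrite /big_compatible pair_part_opp om_opp //.
  by split=> // i j; rewrite delta_opp !ffunE tri_opp.
- move=> U V /big_omP[UM hU] /big_omP[VM hV]; apply/big_omP.
  rewrite /big_compatible pair_part_comp om_comp //; split=> // i j.
  by rewrite delta_comp !ffunE; apply: tri_comp.
move=> U V e UB VB; rewrite inE -[_ && _]/(opposite _ _).
have fin (W : signvec ('I_n + ipair n)%type) : (forall f, ~~ opposite (U f) (V f) -> W f = comp_sign (U f) (V f)) ->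
    forall f, f \notin separation U V -> W f = comp_vec U V f.
  by move=> hW f; rewrite inE ffunE => /hW.
(* To eliminate a pair, no separated index has to be set to zero. *)
case: e => [i0|p] he; last first.
  have [|Z ZE Zp] := @eliminates_pair U V UB VB (val p).1 (val p).2.
    by rewrite !delta_pair !ffunE.
  have [|i|i j|W WB [_ [hW WZ]]] :=
      @eliminates_lift U V UB VB Z (fun i => ~~ opposite (U (inl i)) (V (inl i))) ZE.
  - by [].
  - by move=> /negPf->.
  - by move=> /negPf->.
  exists W => //; split; last exact: fin.
  by rewrite -Zp delta_pair -WZ ffunE.
have [Z ZE hZ] : exists2 Z, eliminates U V Z & forall j,
    ~~ opposite (U (inl j)) (V (inl j)) -> delta Z i0 j = comp_sign (U (inl j)) (V (inl j)).
  case Ui: (U (inl i0)) (he) => //; case Vi: (V (inl i0)) => // _.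
    exact: eliminates_position.
  (* U and V may be swapped, since their composition is commutative where they are not opposite. *)
  have [Z /eliminatesC ZE hZ] := eliminates_position VB UB Vi Ui.
  by exists Z => // j hj; rewrite hZ 1?oppositeC // comp_signC // oppositeC.
have [|i|i j|W WB [W0 [hW _]]] := @eliminates_lift U V UB VB Z
    (fun i => (i == i0) || ~~ opposite (U (inl i)) (V (inl i))) ZE.
- by move=> i ->; rewrite orbT.
- by move=> /orP[/eqP->|/negPf->].
- by move=> /orP[/eqP->|/negPf->//] /orP[/eqP->|/negPf->].
by exists W => //; split; [apply: W0; rewrite ?eqxx | apply: fin].
Qed.

End BigOM.

(** * Zero sets are determined by the face lattice *)

Section Topes.
Variables (E : finType) (L : {set signvec E}).
Hypothesis hL : oriented_matroid L.
Implicit Types (X Y Z T W : signvec E) (e f : E).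

Definition tope T : Prop := T \in L /\ forall Y, Y \in L -> le_vec T Y -> Y = T.

Definition covered W T : Prop := [/\ W \in L, le_vec W T, W <> T &
  forall Y, Y \in L -> le_vec W Y -> le_vec Y T -> Y = W \/ Y = T].

Definition adjacent T T' : Prop := exists2 W, covered W T & le_vec W T'.

(** Counts parallel classes through their closures; a count of elements would not be invariant under
    FL-isomorphism. *)
Definition nsep T T' : nat := #|[set span L [set e] | e in separation T T']|.

Lemma nonloop_neq0 X e : X \in L -> X e != Zero -> e \notin span L set0.
Proof.
move=> XL; apply: contra => /spanP h; rewrite h // => f; by rewrite inE.
Qed.

Lemma tope_neq0 T e : tope T -> e \notin span L set0 -> T e != Zero.
Proof.
move=> [TL Tmax] /spanPn[X XL [_ Xe]]; apply: contra Xe => /eqP Te.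
have := Tmax _ (om_comp hL TL XL) (le_comp _ _) => /ffunP/(_ e).
by rewrite ffunE Te eqxx => ->.
Qed.

Lemma topeI T : T \in L -> (forall e, e \notin span L set0 -> T e != Zero) -> tope T.
Proof.
move=> TL hT; split=> // Y YL hTY; apply: le_vec_anti => //; apply/le_vecP => e Ye.
by rewrite (le_vecP _ _ hTY) ?hT // (nonloop_neq0 YL).
Qed.

Lemma tope_comp X T : X \in L -> tope T -> tope (comp_vec X T).
Proof.
move=> XL hT; apply: topeI => [|e he]; first by rewrite om_comp //; case: hT.
rewrite ffunE; have [_|//] := eqVneq (X e) Zero; exact: tope_neq0.
Qed.

Lemma tope_opp T : tope T -> tope (opp_vec T).
Proof.
move=> hT; apply: topeI => [|e he]; first by rewrite om_opp //; case: hT.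
by rewrite ffunE opp_sign_eq0; apply: tope_neq0.
Qed.

Lemma exists_max_above X (P : pred (signvec E)) : X \in L -> P X ->
  exists2 W, [/\ W \in L, P W & le_vec X W] &
    forall Y, Y \in L -> P Y -> le_vec W Y -> Y = W.
Proof.
move=> XL PX; pose Q Y := [&& Y \in L, P Y & le_vec X Y].
have QX : Q X by rewrite /Q XL PX le_vec_refl.
case: (@arg_minnP _ X Q (fun Y => #|zero_set Y|) QX) => W /and3P[WL PW XW] Wmin.
exists W => // Y YL PY WY; apply/eqP/negPn/negP => /eqP/nesym YW.
have [f Wf Yf] := le_vec_neq WY YW.
have : #|zero_set Y| < #|zero_set W|.
  apply: proper_card; apply/properP; split; last by exists f; rewrite inE ?Wf.
  by apply/subsetP => g; rewrite !inE => /eqP/(le_vec_zero WY)->.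
by rewrite ltnNge Wmin // /Q YL PY (le_vec_trans XW WY).
Qed.

Lemma tope_exists : exists T, tope T.
Proof.
have [T [TL _ _] Tmax] := @exists_max_above (zero_vec E) predT (om_zero hL) isT.
by exists T; split=> // Y YL; apply: Tmax.
Qed.

Lemma tope_sep T T' e : tope T -> tope T' -> T e != T' e -> opposite (T e) (T' e).
Proof.
move=> hT hT' ne.
have he : e \notin span L set0.
  have [Te|Te] := eqVneq (T e) Zero; last by apply: nonloop_neq0 Te; case: hT.
  by apply: (@nonloop_neq0 T'); [case: hT' | rewrite -Te eq_sym].
by have := tope_neq0 hT he; have := tope_neq0 hT' he; move: ne;
  case: (T e) (T' e) => [] [].
Qed.

Lemma tope_neq T T' : T <> T' -> exists e, T e != T' e.
Proof.
move=> ne; apply/existsP; apply: contra_notT ne => /existsPn h.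
by apply/ffunP => e; apply/eqP/negPn/h.
Qed.

(* Eliminating a separated element of T and Y moves Y towards the face of T
   while keeping every coordinate in which Y agrees with T. *)
Lemma conformal T Y : tope T -> Y \in L -> Y <> T ->
  exists2 Z, [/\ Z \in L, le_vec Z T & Z <> T] & forall f, Y f = T f -> Z f = T f.
Proof.
move=> hT; have TL : T \in L by case: hT.
elim: {Y}_.+1 {-2}Y (ltnSn #|separation T Y|) => // m IH Y hm YL YT.
have [s0|[e]] := set_0Vmem (separation T Y).
  exists Y => //; split=> //; apply/le_vecP => f Yf.
  have := tope_neq0 hT (nonloop_neq0 YL Yf).
  have : f \notin separation T Y by rewrite s0 inE.
  by rewrite inE; move: Yf; case: (T f) (Y f) => [] [].
move=> es; have := es; rewrite inE => hop.
have [Z ZL [Ze hZ]] := om_elim hL TL YL hop.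
have [|//||W [WL WT ne] hW] := IH Z.
- apply: leq_trans (proper_card _) (hm : _ <= m); apply/properP; split.
    apply/subsetP => f; apply: contraLR; rewrite !inE => hf.
    by rewrite hZ //; move: hf; case: (T f) (Y f) => [] [].
  by exists e => //; rewrite inE Ze andbC; case: eqVneq => // ->.
- by move=> ZT; move: hop; rewrite -ZT Ze.
exists W => // f Yf; apply: hW; rewrite hZ Yf; last by case: (T f).
by case: (T f).
Qed.

Lemma span1_eq e f : f \notin span L set0 -> f \in span L [set e] ->
  span L [set e] = span L [set f].
Proof.
move=> hf fe; apply/eqP; rewrite eqEsubset !span_trans // sub1set //.
exact: span1_sym.
Qed.

Lemma span1_zero X e f : X \in L -> span L [set e] = span L [set f] ->
  X e = Zero -> X f = Zero.
Proof.
move=> XL hef Xe; have /spanP : f \in span L [set e] by rewrite hef mem_span ?inE.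
by apply=> // g /set1P->.
Qed.

(** Were f not parallel to e, some X would vanish at e and agree with T at f. Applied to the
    composition of W and X, [conformal] would give a covector strictly between W and T. *)
Lemma covered_span W T e f : covered W T -> tope T ->
  e \notin span L set0 -> f \notin span L set0 -> W e = Zero -> W f = Zero ->
  span L [set e] = span L [set f].
Proof.
move=> [WL WT WnT Wcov] hT he hf We Wf; apply: span1_eq => //.
apply/negPn/negP => /spanPn[X XL [Xe Xf]].
have {}Xe : X e = Zero by apply: Xe; rewrite inE.
wlog XTf : X XL Xe Xf / X f = T f.
  move=> hw; have [|ne] := eqVneq (X f) (T f); first exact: (hw X).
  apply: (hw (opp_vec X)); rewrite ?om_opp ?ffunE ?Xe ?opp_sign_eq0 //.
  by have := tope_neq0 hT hf; move: ne Xf; case: (X f) (T f) => [] [].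
have YL := om_comp hL WL XL.
have [|Z [ZL ZT ZnT] hZ] := conformal hT YL.
  move=> /ffunP/(_ e); rewrite ffunE We eqxx Xe => /esym/eqP.
  by rewrite (negPf (tope_neq0 hT he)).
have WZ : le_vec W Z.
  apply/le_vecP => g Wg; have WTg := le_vecP _ _ WT _ Wg.
  by rewrite hZ // ffunE (negPf Wg).
have [ZW|//] := Wcov Z ZL WZ ZT.
have := hZ f; rewrite ffunE Wf eqxx => /(_ XTf); rewrite ZW Wf => /esym/eqP.
by rewrite (negPf (tope_neq0 hT hf)).
Qed.

Lemma adjacent_span T T' e f : tope T -> adjacent T T' ->
  e \in separation T T' -> f \in separation T T' -> span L [set e] = span L [set f].
Proof.
move=> hT [W cW WT'] es fs.
have WT : le_vec W T by case: cW.
have Tn g : g \in separation T T' -> g \notin span L set0 /\ W g = Zero.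
  rewrite inE => /andP[Tg TT']; split; first by apply: nonloop_neq0 Tg; case: hT.
  apply/eqP/negPn/negP => Wg; move: Tg TT'.
  by rewrite -(le_vecP _ _ WT _ Wg) -(le_vecP _ _ WT' _ Wg); case: (W g) Wg.
by have [? ?] := Tn e es; have [? ?] := Tn f fs; apply: covered_span cW hT _ _ _ _.
Qed.

Lemma adjacent_nsep T T' : tope T -> adjacent T T' -> nsep T T' <= 1.
Proof.
move=> hT hTT'; rewrite /nsep; have [->|[e es]] := set_0Vmem (separation T T').
  by rewrite imset0 cards0.
rewrite -(cards1 (span L [set e])); apply: subset_leq_card; apply/subsetP.
by move=> _ /imsetP[f fs ->]; rewrite inE; apply/eqP/(adjacent_span hT hTT').
Qed.

Lemma nsep_refl T : nsep T T = 0.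
Proof.
rewrite /nsep (_ : separation T T = set0) ?imset0 ?cards0 //.
by apply/setP => e; rewrite !inE; case: (T e).
Qed.

Lemma nsep_triangle T T1 T2 : tope T -> tope T1 ->
  nsep T T2 <= nsep T T1 + nsep T1 T2.
Proof.
move=> hT hT1; rewrite /nsep.
apply: leq_trans (leq_card_setU _ _); rewrite -imsetU; apply/subset_leq_card/imsetS.
apply/subsetP => e; rewrite !inE => /andP[Te TT2].
have := tope_neq0 hT1 (nonloop_neq0 (proj1 hT) Te).
by move: Te TT2; case: (T e) (T1 e) (T2 e) => [] [] [].
Qed.

(** The face W of T keeps all coordinates on which T and T' agree, so every non-loop in its zero set
    separates them. Crossing W towards T' removes that class and adds none. *)
Lemma adjacent_closer T T' : tope T -> tope T' -> T <> T' ->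
  exists2 T1, tope T1 /\ adjacent T T1 & nsep T1 T' < nsep T T'.
Proof.
move=> hT hT' ne; have [TL T'L] := (proj1 hT, proj1 hT').
have [|Y [YL YT YnT] hY] := conformal hT T'L; first exact: nesym.
have [|W [WL /andP[WT /eqP WnT] YW] Wmax] :=
  @exists_max_above Y (fun Z => le_vec Z T && (Z != T)) YL.
  by rewrite YT; apply/eqP.
have cW : covered W T.
  split=> // Z ZL WZ ZT; have [->|ZnT] := eqVneq Z T; [by right|left].
  by apply: Wmax; rewrite ?ZT.
have Wsep f : f \notin span L set0 -> W f = Zero -> T' f != T f.
  move=> hf Wf; apply/eqP => /hY; rewrite (le_vec_zero YW Wf) => /esym/eqP.
  by rewrite (negPf (tope_neq0 hT hf)).
exists (comp_vec W T'); first by split; [exact: tope_comp | exists W => //; exact: le_comp].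
have [e We Te] := le_vec_neq WT WnT.
have he := nonloop_neq0 TL Te.
have es : e \in separation T T' by rewrite inE; apply: tope_sep => //; rewrite eq_sym Wsep.
rewrite /nsep; apply: proper_card; apply/properP; split.
  apply/imsetS/subsetP => f; rewrite !inE ffunE; have [_|Wf] := eqVneq (W f) Zero.
    by case: (T' f).
  by rewrite (le_vecP _ _ WT _ Wf).
exists (span L [set e]); first exact: imset_f.
apply/imsetP => -[f]; rewrite inE ffunE => hf /span1_zero/(_ We)-/(_ WL) Wf.
by move: hf; rewrite Wf eqxx; case: (T' f).
Qed.

(** Only the class of e separates T1 from T2, and T lies on the T1 side of it. *)
Lemma nsep_side T T1 T2 e : tope T -> tope T1 -> tope T2 ->
  {in separation T1 T2, forall f, span L [set f] = span L [set e]} ->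
  e \in separation T1 T2 -> T e = T1 e -> nsep T T1 < nsep T T2.
Proof.
move=> hT hT1 hT2 adj es Te; have [TL T1L] := (proj1 hT, proj1 hT1).
have T1e : T1 e != Zero by move: es; rewrite inE => /andP[].
have par f : span L [set f] = span L [set e] -> T f = T1 f.
  move=> hfe; have fe : e \in span L [set f] by rewrite hfe mem_span ?inE.
  case: (span1_parallel hL (nonloop_neq0 T1L T1e) fe) => h; have := h _ TL; have := h _ T1L.
    by rewrite Te => -> ->.
  by rewrite Te => -> /(inv_inj opp_signK).
rewrite /nsep; apply: proper_card; apply/properP; split.
  apply/imsetS/subsetP => f fs; have := fs; rewrite !inE => hf.
  have [<-//|ne] := eqVneq (T1 f) (T2 f).
  have fs' : f \in separation T1 T2 by rewrite inE; apply: tope_sep.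
  by move: hf; rewrite par ?adj //; case: (T1 f).
exists (span L [set e]).
  by apply: imset_f; move: es; rewrite !inE Te.
apply/imsetP => -[f fs /esym/par]; move: fs; rewrite inE => hf Tf.
by move: hf; rewrite Tf; case: (T1 f).
Qed.

Lemma facet_exists e : e \notin span L set0 -> exists T1 T2,
  [/\ tope T1, tope T2, adjacent T1 T2 & e \in separation T1 T2].
Proof.
move=> he; have [T hT] := tope_exists.
(* A maximal covector vanishing at e is a common facet of the two topes obtained by composing it
   with T and with the opposite of T. *)
have [|W [WL /eqP We _] Wmax] :=
  @exists_max_above (zero_vec E) (fun X => X e == Zero) (om_zero hL).
  by rewrite ffunE.
have hT1 := tope_comp WL hT; have hT2 := tope_comp WL (tope_opp hT).
have Te := tope_neq0 hT he.
exists (comp_vec W T), (comp_vec W (opp_vec T)); split=> //; last first.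
  by rewrite inE !ffunE We eqxx; move: Te; case: (T e).
exists W; last exact: le_comp.
split=> //; first exact: le_comp.
  by move=> /ffunP/(_ e); rewrite ffunE We eqxx => /esym/eqP; rewrite (negPf Te).
move=> Y YL WY YT; have [/eqP Ye|Ye] := eqVneq (Y e) Zero; first by left; apply: Wmax.
right; apply: le_vec_anti => //; apply/le_vecP => f Tf; apply/esym/(le_vecP _ _ YT).
have hf := nonloop_neq0 (proj1 hT1) Tf.
have [Wf|Wf] := eqVneq (W f) Zero; last by rewrite -(le_vecP _ _ WY).
have fe : f \in span L [set e].
  apply/negPn/negP => /spanPn[X XL [Xe Xf]].
  have /ffunP/(_ f) : comp_vec W X = W.
    apply: Wmax; rewrite ?om_comp ?le_comp // ffunE We eqxx Xe ?inE //.
  by rewrite ffunE Wf eqxx => /eqP; rewrite (negPf Xf).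
apply: contra Ye => /eqP Yf.
by apply/eqP/(span1_zero YL _ Yf)/esym/span1_eq.
Qed.

End Topes.

(** * Isomorphisms of face posets *)

Section FaceIso.

(** The maps are total on sign vectors and constrained only on covectors, which avoids both subtypes
    and the adjoined top. *)
Definition face_iso (E1 E2 : finType) (L1 : {set signvec E1}) (L2 : {set signvec E2})
    (phi : signvec E1 -> signvec E2) (psi : signvec E2 -> signvec E1) : Prop :=
  [/\ {in L1, forall X, phi X \in L2 /\ psi (phi X) = X},
      {in L2, forall Y, psi Y \in L1 /\ phi (psi Y) = Y} &
      {in L1 &, forall X X', le_vec (phi X) (phi X') = le_vec X X'}].

Lemma face_iso_sym (E1 E2 : finType) (L1 : {set signvec E1}) (L2 : {set signvec E2}) phi psi :
  face_iso L1 L2 phi psi -> face_iso L2 L1 psi phi.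
Proof.
move=> [h1 h2 hle]; split=> // Y Y' /h2[YL hY] /h2[YL' hY'].
by rewrite -hle // hY hY'.
Qed.

Variables (E1 E2 : finType) (L1 : {set signvec E1}) (L2 : {set signvec E2}).
Hypotheses (hL1 : oriented_matroid L1) (hL2 : oriented_matroid L2).
Variables (phi : signvec E1 -> signvec E2) (psi : signvec E2 -> signvec E1).
Hypothesis iso : face_iso L1 L2 phi psi.

Lemma iso_tope T : tope L1 T -> tope L2 (phi T).
Proof.
case: iso => h1 h2 hle [TL Tmax]; split=> [|Y YL]; first by case: (h1 T TL).
have [YL' hY] := h2 Y YL; rewrite -{1}hY hle // => /(Tmax _ YL') hT.
by rewrite -hY hT.
Qed.

Lemma iso_adjacent T T' : tope L1 T -> tope L1 T' ->
  adjacent L1 T T' -> adjacent L2 (phi T) (phi T').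
Proof.
case: iso => h1 h2 hle [TL _] [TL' _] [W [WL WT WnT Wcov] WT'].
exists (phi W); last by rewrite hle.
split; first by case: (h1 W WL).
- by rewrite hle.
- by move=> hWT; apply: WnT; rewrite -(proj2 (h1 W WL)) hWT; case: (h1 T TL).
move=> Y YL; have [YL' hY] := h2 Y YL; rewrite -hY !hle // => WY YT.
by case: (Wcov _ YL' WY YT) => ->; [left|right].
Qed.

(** Walk from T to T' by steps that each come closer; the image of a step crosses at most one class.
    The inverse isomorphism gives equality. *)
Lemma iso_nsep_le T T' : tope L1 T -> tope L1 T' ->
  nsep L2 (phi T) (phi T') <= nsep L1 T T'.
Proof.
elim: {T}_.+1 {-2}T (ltnSn (nsep L1 T T')) => // m IH T hm hT hT'.
have [->|/eqP ne] := eqVneq T T'; first by rewrite nsep_refl.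
have [T1 [hT1 adj] lt] := adjacent_closer hL1 hT hT' ne.
have := nsep_triangle hL2 (phi T') (iso_tope hT) (iso_tope hT1).
have := adjacent_nsep hL2 (iso_tope hT) (iso_adjacent hT hT1 adj).
have := IH T1 (leq_trans lt hm) hT1 hT'; lia.
Qed.

End FaceIso.

Lemma iso_nsep (E1 E2 : finType) (L1 : {set signvec E1}) (L2 : {set signvec E2}) phi psi T T' :
  oriented_matroid L1 -> oriented_matroid L2 -> face_iso L1 L2 phi psi ->
  tope L1 T -> tope L1 T' -> nsep L2 (phi T) (phi T') = nsep L1 T T'.
Proof.
move=> hL1 hL2 iso hT hT'; apply/eqP; rewrite eqn_leq (iso_nsep_le hL1 hL2 iso) //=.
have := iso_nsep_le hL2 hL1 (face_iso_sym iso) (iso_tope iso hT) (iso_tope iso hT').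
by case: iso => h1 _ _; rewrite (proj2 (h1 T (proj1 hT))) (proj2 (h1 T' (proj1 hT'))).
Qed.

(** Composing X with T1 and T2 gives topes above X that differ at e1. Their images lie above [phi X]
    and differ at e2, so [phi X] vanishes there. *)
Lemma iso_zero_side (E1 E2 : finType) (L1 : {set signvec E1}) (L2 : {set signvec E2}) phi psi
    (e1 : E1) (e2 : E2) T1 T2 X :
  oriented_matroid L1 -> face_iso L1 L2 phi psi -> tope L1 T1 -> tope L1 T2 ->
  T1 e1 != T2 e1 ->
  (forall T T', tope L1 T -> tope L1 T' -> T e1 != T' e1 -> phi T e2 != phi T' e2) ->
  X \in L1 -> X e1 = Zero -> phi X e2 = Zero.
Proof.
move=> hL1 [h1 _ hle] hT1 hT2 ne h XL Xe.
have hc T : tope L1 T -> tope L1 (comp_vec X T) /\ comp_vec X T e1 = T e1.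
  by move=> hT; split; [exact: tope_comp | rewrite ffunE Xe].
have [[c1 c1e] [c2 c2e]] := (hc _ hT1, hc _ hT2).
have := h _ _ c1 c2; rewrite c1e c2e => /(_ ne) hne.
apply/eqP; apply: contraNT hne => hX.
have hv T : tope L1 (comp_vec X T) -> phi (comp_vec X T) e2 = phi X e2.
  move=> [cL _]; apply/esym; have : le_vec (phi X) (phi (comp_vec X T)) by rewrite hle ?le_comp.
  by move/le_vecP; apply.
by rewrite !hv.
Qed.

(* By [nsep_side] the two sides of the hyperplane of e are determined by the
   numbers of separating classes, which are distances in the tope graph. *)
Lemma iso_zero (E1 E2 : finType) (L1 : {set signvec E1}) (L2 : {set signvec E2}) phi psi e1 :
  oriented_matroid L1 -> oriented_matroid L2 -> face_iso L1 L2 phi psi ->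
  e1 \notin span L1 set0 -> exists2 e2, e2 \notin span L2 set0 &
    {in L1, forall X, (phi X e2 == Zero) = (X e1 == Zero)}.
Proof.
move=> hL1 hL2 iso he1.
have [T1 [T2 [hT1 hT2 adj es]]] := facet_exists hL1 he1.
have [h1 h2 hle] := iso.
have [T1L T2L] := (proj1 hT1, proj1 hT2).
have [hU1 hU2] := (iso_tope iso hT1, iso_tope iso hT2).
have adj2 := iso_adjacent iso hT1 hT2 adj.
have [e2 ne2] : exists e2, phi T1 e2 != phi T2 e2.
  apply: tope_neq => hTT; move: es.
  by rewrite -(proj2 (h1 _ T1L)) hTT (proj2 (h1 _ T2L)) inE; case: (T2 e1).
have es2 : e2 \in separation (phi T1) (phi T2) by rewrite inE; apply: (tope_sep hL2).
have side (E : finType) (L : {set signvec E}) (S1 S2 T : signvec E) e :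
    oriented_matroid L -> tope L S1 -> tope L S2 -> adjacent L S1 S2 ->
    e \in separation S1 S2 -> tope L T -> (T e == S1 e) = (nsep L T S1 < nsep L T S2).
  move=> hL hS1 hS2 ad eS hT; have spanS : {in separation S1 S2, forall f, span L [set f] = span L [set e]}.
    by move=> f fS; apply: (adjacent_span hL hS1 ad fS eS).
  apply/eqP/idP; first exact: nsep_side.
  move=> lt; apply/eqP/negPn/negP => ne.
  have sepC : separation S2 S1 = separation S1 S2.
    by apply/setP => f; rewrite !inE; case: (S1 f) (S2 f) => [] [].
  have := @nsep_side _ _ hL T S2 S1 e hT hS2 hS1; rewrite sepC => /(_ spanS eS).
  have ho := tope_sep hL hT hS1 ne; have -> : T e = S2 e.
    by move: eS ho; rewrite inE; case: (S1 e) (S2 e) (T e) => [] [] [].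
  by move=> /(_ erefl); rewrite ltnNge ltnW.
have agree T : tope L1 T -> (phi T e2 == phi T1 e2) = (T e1 == T1 e1).
  move=> hT; rewrite (side _ _ _ _ _ _ hL2 hU1 hU2 adj2 es2 (iso_tope iso hT)).
  by rewrite !(iso_nsep hL1 hL2 iso) // -(side _ _ _ _ _ _ hL1 hT1 hT2 adj es hT).
have he2 : e2 \notin span L2 set0.
  by apply: (nonloop_neq0 (proj1 hU1)); move: es2; rewrite inE => /andP[].
(* Topes take only two values at a non-loop, so comparing both with a reference tope compares them
   with each other. *)
have two (E : finType) (L : {set signvec E}) (S1 S T : signvec E) e : oriented_matroid L ->
    e \notin span L set0 -> tope L S1 -> tope L S -> tope L T ->
    (T e == S e) = ((T e == S1 e) == (S e == S1 e)).
  move=> hL he /(tope_neq0 hL)/(_ he) + /(tope_neq0 hL)/(_ he) + /(tope_neq0 hL)/(_ he).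
  by case: (S1 e) (S e) (T e) => [] [] [].
have ne1 : T1 e1 != T2 e1 by move: es; rewrite inE; case: (T1 e1) (T2 e1) => [] [].
have agree2 T T' : tope L1 T -> tope L1 T' ->
    (phi T e2 == phi T' e2) = (T e1 == T' e1).
  move=> hT hT'; rewrite (two _ _ _ _ _ _ hL2 he2 hU1 (iso_tope iso hT') (iso_tope iso hT)).
  by rewrite !agree // -(two _ _ _ _ _ _ hL1 he1 hT1 hT' hT).
exists e2 => // X XL; apply/eqP/eqP => hX.
  rewrite -(proj2 (h1 _ XL)); apply: (iso_zero_side hL2 (face_iso_sym iso) hU1 hU2 ne2) => //.
    move=> T T' hT hT'; apply: contra.
    have [hsT hsT'] := (iso_tope (face_iso_sym iso) hT, iso_tope (face_iso_sym iso) hT').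
    rewrite -(agree2 _ _ hsT hsT').
    by rewrite (proj2 (h2 _ (proj1 hT))) (proj2 (h2 _ (proj1 hT'))).
  by case: (h1 _ XL).
apply: (iso_zero_side hL1 iso hT1 hT2 ne1) hX => // T T' hT hT'.
by rewrite agree2.
Qed.

Lemma FL_isomorphicP (E E' : finType) (L : {set signvec E}) (L' : {set signvec E'}) :
  FL_isomorphic L L' <-> exists phi psi, face_iso L L' phi psi.
Proof.
split=> [[f [g fK gK] hf]|[phi [psi [h1 h2 hle]]]].
  have hg x y : big_face_le (g x) (g y) = big_face_le x y by rewrite -hf !gK.
  have f0 : f None = None.
    have : big_face_le (f (g None)) (f None) by rewrite hf; case: (g None).
    by rewrite gK; case: (f None).
  have g0 : g None = None by rewrite -f0 fK.
  (* The default value is never met on covectors: an isomorphism sends only the top to the top. *)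
  pose out (F : finType) (K : {set signvec F}) (x : big_face K) :=
    if x is Some y then val y else zero_vec F.
  have fin (X : signvec E) (XL : X \in L) :
      exists2 y, f (insub X) = Some y & insub X = Some (exist _ X XL) :> big_face L.
    rewrite insubT; case Ef : (f _) => [y|]; first by exists y.
    by move: Ef; rewrite -{1}f0 => /(can_inj fK).
  have gin (Y : signvec E') (YL : Y \in L') :
      exists2 y, g (insub Y) = Some y & insub Y = Some (exist _ Y YL) :> big_face L'.
    rewrite insubT; case Ef : (g _) => [y|]; first by exists y.
    by move: Ef; rewrite -{1}g0 => /(can_inj gK).
  exists (fun X => out _ L' (f (insub X))), (fun Y => out _ L (g (insub Y))); split.
  - move=> X XL; have [y fy hX] := fin X XL; rewrite fy /=; split; first exact: valP.
    by rewrite valK -fy fK hX.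
  - move=> Y YL; have [y gy hY] := gin Y YL; rewrite gy /=; split; first exact: valP.
    by rewrite valK -gy gK hY.
  - move=> X X' XL XL'; have [y fy hX] := fin X XL; have [y' fy' hX'] := fin X' XL'.
    by have := hf (insub X) (insub X'); rewrite fy fy' hX hX'.
exists (fun x : big_face L => (if x is Some X then insub (phi (val X)) else None) : big_face L').
  exists (fun y : big_face L' => (if y is Some Y then insub (psi (val Y)) else None) : big_face L).
    move=> [[X XL]|] //=; have [h hX] := h1 X XL; rewrite insubT /= hX insubT.
    by congr Some; apply: val_inj.
  move=> [[Y YL]|] //=; have [h hY] := h2 Y YL; rewrite insubT /= hY insubT.
  by congr Some; apply: val_inj.
have ins X (XL : X \in L) : 
    insub (phi X) = Some (exist (fun Y => Y \in L') (phi X) (proj1 (h1 X XL))) :> big_face L'.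
  exact: insubT.
by move=> [[X XL]|] [[Y YL]|] //=; rewrite !ins //=; apply: hle.
Qed.

(** * Tightness from lines *)

Section Forward.
Variables (E : finType) (L : {set signvec E}).
Hypotheses (hL : oriented_matroid L) (hs : simple_om L).

Lemma simple_restrict (A : {set E}) : simple_om (restrict L A).
Proof.
have sE X e : restrict_vec A X e = X (val e) by rewrite ffunE.
split=> [e he|e f ef [] h].
- apply: (proj1 hs (val e)) => X XL; rewrite -sE; apply/he/imset_f => //.
- apply: (proj2 hs (val e) (val f)); first by [].
  by left=> X XL; rewrite -!sE; apply/h/imset_f.
- apply: (proj2 hs (val e) (val f)); first by [].
  by right=> X XL; rewrite -!sE; apply/h/imset_f.
Qed.

Lemma restrict_span (A : {set E}) (B : {set {x | x \in A}}) e :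
  (e \in span (restrict L A) B) = (val e \in span L (val @: B)).
Proof. by rewrite restrictE pull_span. Qed.

(** If F minus z stayed modular, the line through i and j would meet it in some w other than z. This
    line, spanned by z and w, would then lie in F. *)
Lemma tight_of_lines (F : {set E}) : flat L F -> F != setT -> lines_meet L F ->
  (forall z, z \in F -> exists i j, [/\ i \notin F, j \notin F, i != j &
     z \in span L [set i; j]]) -> tight_modular_hyperplane L F.
Proof.
move=> fF FT hF hz; have hl := simple_loopless hs.
split=> [|z zF hmod]; first exact: lines_modular.
have [i [j [iF jF ij zij]]] := hz z zF.
have iz : i \in [set~ z] by rewrite !inE; apply: contraNneq iF => ->.
have jz : j \in [set~ z] by rewrite !inE; apply: contraNneq jF => ->.
have [] := modular_lines (restrict_om _ hL) (simple_restrict _) hmod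
  (i := exist _ i iz) (j := exist _ j jz); rewrite ?inE //.
move=> [w /= wz]; rewrite inE /= => wF; rewrite restrict_span /=.
have -> : val @: [set exist _ i iz; exist _ j jz] = [set i; j].
  by rewrite imsetU !imset_set1.
move=> wij; have {}wz : w != z by move: wz; rewrite !inE.
have wi : w \notin span L [set i].
  apply: contra iF => /(span1_sym hL (hl w)); apply/subsetP/flat_span_subset => //.
  by rewrite sub1set.
have hj : j \in span L (w |: [set i]).
  by apply: span_exchange; rewrite // setUC.
have hzw : z \in span L (i |: [set w]).
  apply: (subsetP (span_trans _) _ zij); rewrite subUset !sub1set setUC hj andbT.
  by apply: mem_span; rewrite !inE eqxx orbT.
have zw : z \notin span L [set w].
  by apply: contra wz => h; rewrite (simple_span1 hL hs h).
have := span_exchange hL hzw zw.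
apply/negP; apply: contra iF; apply/subsetP/flat_span_subset => //.
by rewrite subUset !sub1set zF.
Qed.

End Forward.

(** * The hyperplane of the pairs *)

Lemma big_tri n (M : {set signvec (ipair n)}) U (p : ipair n) :
  sweep_oriented_matroid M -> U \in big_om M ->
  tri (U (inl (val p).1)) (U (inl (val p).2)) (U (inr p)).
Proof.
move=> hM /(big_omP hM)[_ /(_ (val p).1 (val p).2)].
by rewrite delta_pair ffunE.
Qed.

Lemma pair_of n (a b : 'I_n) : a != b ->
  exists p : ipair n, val p = (a, b) \/ val p = (b, a).
Proof.
case: (delta_cases a b) => [[-> _]|[p hp _]|[p hp _] _]; first by rewrite eqxx.
  by exists p; left.
by exists p; right.
Qed.

Section SweepToHyperplane.
Variables (E : finType) (L : {set signvec E}) (n : nat) (M : {set signvec (ipair n)}).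
Hypotheses (hL : oriented_matroid L) (hs : simple_om L) (n_gt0 : 0 < n).
Hypotheses (hM : sweep_oriented_matroid M) (hFL : FL_isomorphic L (big_om M)).

Lemma tight_of_sweep : exists F : {set E}, tight_modular_hyperplane L F.
Proof.
have hB := big_om_oriented hM; have hl := simple_loopless hs.
have [phi [psi iso]] := (proj1 (FL_isomorphicP _ _)) hFL.
have [h1 h2 hle] := iso.
(* Equality of zeros is all that closure sees. *)
pose same e e' := {in L, forall X, (phi X e' == Zero) = (X e == Zero)}.
have toB e : exists2 e', e' \notin span (big_om M) set0 & same e e'.
  exact: (iso_zero hL hB iso (hl e)).
have toL e' : e' \notin span (big_om M) set0 -> exists e, same e e'.
  move=> he'; have [e _ he] := iso_zero hB hL (face_iso_sym iso) he'.
  exists e => X XL; have [XB hX] := h1 X XL; by have := he _ XB; rewrite hX.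
(* A single block, wholly beyond the cut; its zero set carried over to [L] is the hyperplane
   sought. *)
pose P : signvec ('I_n + ipair n)%type := [ffun e => if e is inl _ then Pos else Zero].
have PB : P \in big_om M.
  apply/(big_omP hM); have P0 : pair_part P = zero_vec _ by apply/ffunP => p; rewrite !ffunE.
  rewrite /big_compatible P0; split; first exact/om_zero/(proj1 hM).
  by move=> i j; rewrite !ffunE.
have [PL hP] := h2 _ PB.
have inlN a : inl a \notin span (big_om M) set0.
  by apply: (nonloop_neq0 PB); rewrite ffunE.
have memF e e' : same e e' -> (e \in zero_set (psi P)) = (if e' is inr _ then true else false).
  by move=> he; rewrite inE -he // hP ffunE; case: e' he.
(* A pair that is a loop would make its two indices vanish together, and L is simple. *)
have same_neq i j a b (p : ipair n) : same i (inl a) -> same j (inl b) ->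
    (forall U, U \in big_om M -> U (inr p) = Zero -> U (inl a) = Zero -> U (inl b) = Zero) ->
    (forall U, U \in big_om M -> U (inr p) = Zero) -> i = j.
  move=> ia jb hp hp0; apply/esym/(simple_span1 hL hs)/spanP => X XL /(_ i).
  rewrite inE eqxx => /(_ isT) Xi; apply/eqP; rewrite -jb //; apply/eqP.
  have [XB _] := h1 X XL; apply: hp => //; first exact: hp0.
  by apply/eqP; rewrite ia // Xi.
exists (zero_set (psi P)); apply: (tight_of_lines hL hs).
- by apply/exists_inP; exists (psi P).
- have [e he] := toL _ (inlN (Ordinal n_gt0)).
  by apply/eqP => /setP/(_ e); rewrite in_setT (memF _ _ he).
- move=> i j; have [i' _ hi] := toB i; have [j' _ hj] := toB j.
  rewrite (memF _ _ hi) (memF _ _ hj); case: i' j' hi hj => [a|//] [b|//] hi hj _ _ ij.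
  have ab : a != b.
    apply: contraNneq ij => ab; apply/eqP/(simple_span1 hL hs)/spanP => X XL /(_ j).
    rewrite inE eqxx => /(_ isT) Xj; apply/eqP.
    by rewrite -hi // ab hj // Xj.
  have [p hp] := pair_of ab.
  have tp U : U \in big_om M -> U (inl a) = Zero -> (U (inl b) == Zero) = (U (inr p) == Zero).
    by move=> /(big_tri p hM); case: hp => -> /= + Ua; rewrite Ua; case: (U _) (U _) => [] [].
  have pN : inr p \notin span (big_om M) set0.
    apply/negP => /spanP p0; move/eqP: ij; apply.
    have p0' U : U \in big_om M -> U (inr p) = Zero by move=> UB; apply: p0 => // f; rewrite inE.
    by apply: (same_neq _ _ _ _ p hi hj) => // U UB Up Ua; apply/eqP; rewrite tp // Up.
  have [z hz] := toL _ pN; exists z; first by rewrite (memF _ _ hz).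
  apply/spanP => X XL hX; apply/eqP; have [XB _] := h1 X XL; rewrite -hz //.
  have Xa : phi X (inl a) = Zero by apply/eqP; rewrite hi // hX // !inE eqxx.
  have Xb : phi X (inl b) = Zero by apply/eqP; rewrite hj // hX // !inE eqxx orbT.
  by rewrite -tp // Xb.
- move=> z; have [z' z'N hz] := toB z; rewrite (memF _ _ hz); case: z' z'N hz => // p pN hz _.
  case hp : (val p) => [a b].
  have [i hi] := toL _ (inlN a); have [j hj] := toL _ (inlN b).
  have tp U : U \in big_om M -> tri (U (inl a)) (U (inl b)) (U (inr p)).
    by move=> /(big_tri p hM); rewrite hp.
  exists i, j; split; rewrite ?(memF _ _ hi) ?(memF _ _ hj) //.
    (* Were i and j equal, moving the origin to a would make a and b both zero without changing the
       pairs, contradicting [Up]. *)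
    apply/eqP => ij; move: pN => /spanPn[U UB [_ Up]].
    have UM : pair_part U \in M by case/(big_omP hM): UB.
    have [i0 j0 /eqP-> /eqP->|W WB [hW Wa]] := @big_extend _ _ hM _ (pred1 a) (fun=> Zero) UM.
      by rewrite delta_refl.
    have {}Wa : W (inl a) = Zero by apply: Wa => /=.
    have [XL hX] := h2 _ WB.
    have Wb : W (inl b) = Zero.
      by apply/eqP; rewrite -hX hj // -ij -hi // hX Wa.
    have := tp _ WB; rewrite Wa Wb /= => /eqP Wp.
    have /ffunP/(_ p) := hW; rewrite !ffunE Wp => /esym/eqP; by rewrite (negPf Up).
  apply/spanP => X XL hX; have [XB _] := h1 X XL; apply/eqP; rewrite -hz //.
  have Xa : phi X (inl a) = Zero by apply/eqP; rewrite hi // hX // !inE eqxx.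
  have Xb : phi X (inl b) = Zero by apply/eqP; rewrite hj // hX // !inE eqxx orbT.
  by have := tp _ XB; rewrite Xa Xb.
Qed.

End SweepToHyperplane.

(** * The sweep oriented matroid of a tight modular hyperplane *)

(** Surjectivity of g keeps every coordinate visible, so the pullback reflects the order and is
    injective. *)
Lemma pull_face_iso (E E' : finType) (g : E' -> E) (r : E' -> bool) (L : {set signvec E}) :
  (forall e, exists e', g e' = e) ->
  exists psi, face_iso L (pull g r @: L) (pull g r) psi.
Proof.
move=> gS; pose psi Y := odflt (zero_vec E) [pick X in L | pull g r X == Y].
have hle X X' : le_vec (pull g r X) (pull g r X') = le_vec X X'.
  apply/le_vecP/le_vecP => h e he; last first.
    by rewrite !ffunE h // -(pull_eq0 g r).
  have [e' ee'] := gS e; have := h e'; rewrite pull_eq0 ee' => /(_ he).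
  by rewrite !ffunE ee'; case: (r e') => // /(inv_inj opp_signK).
have inj : injective (pull g r).
  by move=> X X' hX; apply: le_vec_anti; rewrite -hle hX le_vec_refl.
have psiP X : X \in L -> psi (pull g r X) = X.
  move=> XL; rewrite /psi; case: pickP => [X' /andP[_ /eqP/inj->]//|/(_ X)].
  by rewrite XL eqxx.
exists psi; split=> [X XL|_ /imsetP[X XL ->]|//].
  by rewrite imset_f ?psiP.
by rewrite psiP.
Qed.

(** * Orienting the third point of a line *)

Section TriOrient.
Variables (E : finType) (L : {set signvec E}) (e1 e2 e3 : E) (P : signvec E).
Hypotheses (hL : oriented_matroid L) (PL : P \in L).
Hypotheses (P1 : P e1 = Pos) (P2 : P e2 = Pos) (P3 : P e3 = Zero).
Hypothesis z12 : forall X, X \in L -> X e1 = Zero -> X e2 = Zero -> X e3 = Zero.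
Hypothesis z13 : forall X, X \in L -> X e1 = Zero -> X e3 = Zero -> X e2 = Zero.
Hypothesis z23 : forall X, X \in L -> X e2 = Zero -> X e3 = Zero -> X e1 = Zero.

Lemma tri_orient Y : Y \in L -> Y e1 = Zero -> Y e2 != Zero ->
  exists r : bool, forall X, X \in L ->
  tri (X e1) (X e2) (if r then opp_sign (X e3) else X e3).
Proof.
move=> YL Y1 Y2n; wlog Y2 : Y YL Y1 Y2n / Y e2 = Pos.
  move=> hw; case Ye2 : (Y e2) Y2n => // _; last by apply: (hw Y); rewrite ?Ye2.
  by apply: (hw (opp_vec Y)); rewrite ?om_opp ?ffunE ?Y1 ?Ye2.
have Y3 : Y e3 != Zero by apply/eqP => /(z13 YL Y1); rewrite Y2.
pose r := Y e3 == Neg; exists r.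
(* X and P both vanish at e3, so eliminating e1 or e2 between them kills the other too. *)
have flat3 X : X \in L -> X e3 = Zero -> X e1 = X e2.
  move=> XL X3.
  have [hop|] := boolP (opposite (X e2) (P e2)).
    have [Z ZL [Z2 hZ]] := om_elim hL XL PL hop.
    have Z1 : Z e1 = Zero by apply: z23; rewrite // hZ X3 ?P3.
    move: Z1 hop; have := hZ e1; rewrite P1 P2.
    by case: (X e1) (X e2) => [] [] //= -> //.
  have [hop|] := boolP (opposite (X e1) (P e1)).
    have [Z ZL [Z1 hZ]] := om_elim hL XL PL hop.
    have Z2 : Z e2 = Zero by apply: z13; rewrite // hZ X3 ?P3.
    move: Z2 hop; have := hZ e2; rewrite P1 P2.
    by case: (X e1) (X e2) => [] [] //= -> //.
  rewrite P1 P2; have := z13 XL; have := z23 XL; rewrite X3.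
  by case: (X e1) (X e2) => [] [] //= h h'; rewrite ?h ?h'.
(* Y has x1 = 0 and x2 > 0, so its sign at e3 must encode a positive difference. *)
have pos X : X \in L -> X e3 = Y e3 -> tri (X e1) (X e2) Pos.
  have half W : W \in L -> W e3 = Y e3 -> W e1 = Pos -> W e2 <> Zero.
    move=> WL W3 W1 W2; have [|Z ZL [Z3 hZ]] := om_elim hL WL (om_opp hL YL) (e := e3).
      by rewrite ffunE W3; case: (Y e3) Y3.
    have Z1 : Z e1 = Pos by rewrite hZ ffunE W1 Y1.
    have Z2 : Z e2 = Neg by rewrite hZ ffunE W2 Y2.
    by have := flat3 Z ZL Z3; rewrite Z1 Z2.
  move=> XL X3; case X2 : (X e2); case X1 : (X e1) => //.
  - have [|Z ZL [Z2 hZ]] := om_elim hL XL YL (e := e2); first by rewrite X2 Y2.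
    have Z1 : Z e1 = Zero by rewrite hZ X1 Y1.
    have Z3 : Z e3 = Y e3 by rewrite hZ X3; case: (Y e3).
    by move: Y3; rewrite -Z3 (z12 ZL).
  - have [|Z ZL [Z2 hZ]] := om_elim hL XL YL (e := e2); first by rewrite X2 Y2.
    have Z1 : Z e1 = Pos by rewrite hZ X1 Y1.
    have Z3 : Z e3 = Y e3 by rewrite hZ X3; case: (Y e3).
    by case: (half Z ZL Z3 Z1).
  - by move: Y3; rewrite -X3 (z12 XL).
  - by case: (half X XL).
move=> X XL; have Yr : (if r then opp_sign (Y e3) else Y e3) = Pos.
  by rewrite /r; case: (Y e3) Y3.
have [X3|X3] := eqVneq (X e3) Zero.
  by rewrite X3 (flat3 X) // if_same; case: (X e2).
have [X3Y|ne] := eqVneq (X e3) (Y e3); first by rewrite X3Y Yr; apply: pos.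
have X3Y : opp_sign (X e3) = Y e3 by move: X3 ne Y3; case: (X e3) (Y e3) => [] [].
have := pos (opp_vec X); rewrite om_opp // !ffunE X3Y => /(_ isT erefl).
by rewrite -[Pos]Yr -X3Y -tri_opp !opp_signK; case: (r); rewrite ?opp_signK.
Qed.

End TriOrient.

(** * Recovering the sweep oriented matroid from its cuts *)

Section LinesToSweep.
Variables (n : nat) (L : {set signvec ('I_n + ipair n)%type}).
Hypothesis hL : oriented_matroid L.
Hypothesis triL : forall U (p : ipair n), U \in L ->
  tri (U (inl (val p).1)) (U (inl (val p).2)) (U (inr p)).
Let P : signvec ('I_n + ipair n)%type := [ffun e => if e is inl _ then Pos else Zero].
Hypothesis PL : P \in L.
Implicit Types (U V W : signvec ('I_n + ipair n)%type).

Lemma tri_delta U i j : U \in L -> tri (U (inl i)) (U (inl j)) (delta (pair_part U) i j).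
Proof.
move=> UL; case: (delta_cases i j) => [[-> ->]|[p hp ->]|[p hp ->]].
- by case: (U _).
- by have := triL p UL; rewrite hp ffunE.
- by have := triL p UL; rewrite hp ffunE tri_sym.
Qed.

(** Eliminate i between the compositions of P and of its opposite with U; on pairs both coincide
    with U. *)
Lemma shift_to_zero U i : U \in L ->
  exists2 V, V \in L & pair_part V = pair_part U /\
    forall j, V (inl j) = delta (pair_part U) i j.
Proof.
move=> UL; have [|V VL [Vi hV]] := om_elim hL (om_comp hL PL UL)
   (om_comp hL (om_opp hL PL) UL) (e := inl i); first by rewrite !ffunE.
have VU : pair_part V = pair_part U.
  apply/ffunP => p; rewrite !ffunE hV !ffunE /=; by case: (U _).
exists V => //; split=> // j; have := tri_delta i j VL.
by rewrite Vi VU /= => /eqP.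
Qed.

Lemma pair_part_sweep U : U \in L ->
  exists2 I, ordered_partition I & pair_part U = sweep_covector I.
Proof.
move=> UL; set X := pair_part U.
(* With the origin at i the index signs become differences, so compatibility expresses
   transitivity. *)
have step i j k : tri (delta X i k) (delta X i j) (delta X k j).
  have [V VL [VU hV]] := shift_to_zero i UL.
  by rewrite -!hV /X -VU; apply: tri_delta.
(* The height of i is the number of indices strictly below it. *)
pose p i := #|[set k | delta X k i == Pos]|.
have lt i j : delta X i j = Pos -> p i < p j.
  move=> ij; apply: proper_card; apply/properP; split.
    apply/subsetP => k; rewrite !inE delta_sym => ki; have := step i j k.
    by rewrite ij; case: (delta X i k) ki.
  by exists i; rewrite !inE ?ij ?delta_refl.
have [I hI hp] := ordered_partition_of p; exists I => //.
apply: delta_inj => i j; rewrite delta_sweep hp /cmp.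
case dij : (delta X i j).
- by rewrite ltnNge ltnW ?lt // delta_sym dij.
- suff -> : p i = p j by rewrite ltnn.
  apply: eq_card => k; rewrite !inE; have := step i j k; rewrite dij (delta_sym X i k).
  by case: (delta X i k) (delta X k j) => [] [].
- by rewrite lt.
Qed.

Lemma sweep_of_pairs : sweep_oriented_matroid ([set pair_part U | U in L]).
Proof.
split=> [|_ /imsetP[U UL ->]]; last exact: pair_part_sweep.
suff -> : [set pair_part U | U in L] = pull inr (fun=> false) @: L by apply: pull_om.
by apply: eq_imset => U; apply/ffunP => p; rewrite !ffunE.
Qed.

Lemma eq_big_om_pairs : L = big_om ([set pair_part U | U in L]).
Proof.
apply/setP => U; apply/idP/(big_omP sweep_of_pairs) => [UL|[/imsetP[W WL UW] hU]].
  by split; [exact: imset_f | move=> i j; apply: tri_delta].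
have eqL V : V \in L -> pair_part V = pair_part U ->
    (forall i, V (inl i) = U (inl i)) -> U \in L.
  move=> VL VU hV; suff -> : U = V by [].
  by apply/ffunP => -[i|p] //; have /ffunP/(_ p) := VU; rewrite !ffunE.
have [/existsP[i /eqP Ui]|/existsPn nz] := boolP [exists i, U (inl i) == Zero].
  have [V VL [VW hV]] := shift_to_zero i WL; apply: (eqL V) => // [|j].
    by rewrite VW UW.
  by have := hU i j; rewrite hV -UW Ui /= => /eqP.
have [/existsP[i1 hi1]|/existsPn nn] := boolP [exists i, U (inl i) == Neg]; last first.
  apply: (eqL (comp_vec P W)) => [||i]; first exact: om_comp.
    by rewrite UW; apply/ffunP => p; rewrite !ffunE.
  by rewrite !ffunE /=; have := nz i; have := nn i; case: (U _).
have [I hI UI] := pair_part_sweep WL; rewrite -UW in UI.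
case: (@arg_maxnP _ i1 (fun i => U (inl i) == Neg) (block_index I) hi1) => i /= /eqP Ui hmax.
have [V VL [VW hV]] := shift_to_zero i WL.
(* The origin is placed in the last negative block; composing with the opposite of P then makes that
   block negative. *)
apply: (eqL (comp_vec V (opp_vec P))) => [||j].
- by apply: om_comp => //; apply: om_opp.
- by rewrite UW -VW; apply/ffunP => p; rewrite !ffunE; case: (V _).
rewrite !ffunE hV -UW; have := hU i j; have := nz j; have := hmax j.
rewrite Ui UI delta_sweep /cmp; case: ltngtP => /=; last 2 first.
- by case: (U (inl j)).
- by case: (U (inl j)).
by case: (U (inl j)) => //= _ /(_ isT).
Qed.

End LinesToSweep.

(** * Coordinates adapted to a tight modular hyperplane *)

Section HyperplaneToSweep.
Variables (E : finType) (L : {set signvec E}) (F : {set E}).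
Hypotheses (hL : oriented_matroid L) (hs : simple_om L).
Hypothesis hF : tight_modular_hyperplane L F.

Let fF : flat L F. Proof. by case: hF => -[[]]. Qed.
Let hl := simple_loopless hs.

Lemma tight_neqT : F != setT.
Proof.
apply/eqP => FT; case: hF => -[[_ + _] _]; rewrite FT flat_rank_setT //; lia.
Qed.

(** Otherwise every line through two outside elements would meet F in a point other than z, and F
    minus z would be a modular hyperplane after deleting z. *)
Lemma tight_pair z : z \in F -> exists i j, [/\ i \notin F, j \notin F, i != j &
  forall w, w \in F -> w \in span L [set i; j] -> w = z].
Proof.
move=> zF; pose ok i j := [&& i \notin F, j \notin F, i != j &
  [forall w in F, (w \in span L [set i; j]) ==> (w == z)]].
have [/existsP[i /existsP[j /and4P[iF jF ij /forall_inP h]]]|/existsPn hno] :=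
    boolP [exists i, exists j, ok i j].
  by exists i, j; split=> // w wF wij; apply/eqP/(implyP (h w wF)).
case: hF => _ /(_ z zF)[].
have [i iF] : exists i, i \notin F.
  apply/existsP; apply: contraR tight_neqT => /existsPn h; apply/eqP/setP => e.
  by rewrite in_setT; apply/negPn/h.
have out e : e \notin F -> e \in [set~ z].
  by rewrite !inE; apply: contraNneq => ->.
apply: lines_modular.
- exact: restrict_om.
- exact/simple_loopless/simple_restrict.
- case/exists_inP: fF => X XL FX; apply/exists_inP; exists (restrict_vec _ X).
    exact: imset_f.
  by apply/eqP/setP => e; rewrite !inE ffunE (eqP FX) inE.
- move=> j k; rewrite !inE => jF kF jk.
  have := hno (val j); rewrite negb_exists => /forallP/(_ (val k)).
  rewrite /ok jF kF (inj_eq val_inj) jk /= => /forall_inPn[w wF].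
  rewrite negb_imply => /andP[wjk wz].
  have wz' : w \in [set~ z] by rewrite !inE.
  exists (exist _ w wz'); first by rewrite inE.
  by rewrite restrict_span imsetU !imset_set1.
- by apply/eqP => /setP/(_ (exist _ i (out i iF))); rewrite !inE /= (negPf iF).
Qed.

Lemma line_tri (i j : E) (P : signvec E) : P \in L -> F = zero_set P ->
  i \notin F -> j \notin F -> i != j ->
  exists2 z, z \in F & z \in span L [set i; j] /\ exists r : bool, forall X, X \in L ->
    tri (if P i == Neg then opp_sign (X i) else X i)
        (if P j == Neg then opp_sign (X j) else X j)
        (if r then opp_sign (X z) else X z).
Proof.
move=> PL FP iF jF ij.
have [z zF zij] := modular_lines hL hs (proj1 hF) iF jF ij.
exists z => //; split=> //.
pose o e := P e == Neg; pose L0 := pull id o @: L.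
have hL0 : oriented_matroid L0 by apply: pull_om.
have z0 A e : (e \in span L0 A) = (e \in span L A) by rewrite pull_span imset_id.
have zsp A e X : e \in span L A -> X \in L0 -> (forall f, f \in A -> X f = Zero) -> X e = Zero.
  by rewrite -z0 => /spanP; apply.
have zi k : k \notin F -> z \notin span L [set k].
  move=> kF; apply: contra kF => /(span1_sym hL (hl z)).
  by apply/subsetP/flat_span_subset => //; rewrite sub1set.
have zj : j \in span L [set z; i].
  by apply: span_exchange; [| rewrite setUC | exact: zi].
have zi' : i \in span L [set z; j].
  by apply: span_exchange => //; exact: zi.
have ji : j \notin span L0 [set i].
  by rewrite z0; apply: contra ij => /(simple_span1 hL hs)->.
(* As i and j are not parallel, some covector vanishes at i but not at j; it decides the orientation
   of z. *)
have [Y YL0 [Yi Yj]] := spanPn ji.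
have P0 e : e \notin F -> pull id o P e = Pos.
  by rewrite FP inE ffunE /o; case: (P e).
have [|||||||||r hr] := @tri_orient _ L0 i j z (pull id o P) hL0 _ _ _ _ _ _ _ Y YL0.
- exact: imset_f.
- exact: P0.
- exact: P0.
- by move: zF; rewrite FP inE => /eqP Pz; rewrite ffunE Pz if_same.
- by move=> X XL0 Xi Xj; apply: (zsp _ _ _ zij) => // f /set2P[]->.
- by move=> X XL0 Xi Xz; apply: (zsp _ _ _ zj) => // f /set2P[]->.
- by move=> X XL0 Xj Xz; apply: (zsp _ _ _ zi') => // f /set2P[]->.
- by apply: Yi; rewrite inE.
- by [].
exists r => X XL; have := hr _ (imset_f (pull id o) XL); rewrite !ffunE.
by move: zF; rewrite FP inE /o => /eqP->.
Qed.

Lemma sweep_of_tight : exists (n : nat) (M : {set signvec (ipair n)}),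
  0 < n /\ sweep_oriented_matroid M /\ FL_isomorphic L (big_om M).
Proof.
have [P PL /eqP FP] := exists_inP fF.
pose n := #|~: F|; pose el (i : 'I_n) : E := enum_val i.
have elF i : el i \notin F by have := enum_valP i; rewrite inE.
have el_inj : injective el by apply: enum_val_inj.
have elS e : e \notin F -> exists i, el i = e.
  move=> eF; have eF' : e \in ~: F by rewrite inE.
  by exists (enum_rank_in eF' e); rewrite /el enum_rankK_in.
have n0 : 0 < n.
  rewrite card_gt0; apply: contraNneq tight_neqT => h.
  by rewrite -(setCK F) h setC0.
have pick_z (p : ipair n) : exists zr : E * bool, [/\ zr.1 \in F,
    zr.1 \in span L [set el (val p).1; el (val p).2] & forall X, X \in L ->
    tri (if P (el (val p).1) == Neg then opp_sign (X (el (val p).1)) else X (el (val p).1))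
        (if P (el (val p).2) == Neg then opp_sign (X (el (val p).2)) else X (el (val p).2))
        (if zr.2 then opp_sign (X zr.1) else X zr.1)].
  have ne : el (val p).1 != el (val p).2.
    rewrite (inj_eq el_inj); apply/eqP => h; have := valP p.
    by rewrite h ltnn.
  have [z zF [zp [r hr]]] := line_tri PL FP (elF _) (elF _) ne.
  by exists (z, r).
have [zr hzr] := fin_all_exists pick_z.
(* One point of F may serve several pairs, so [g] need not be injective. *)
pose g (e : 'I_n + ipair n) := match e with inl i => el i | inr p => (zr p).1 end.
pose r (e : 'I_n + ipair n) := match e with inl i => P (el i) == Neg | inr p => (zr p).2 end.
(* Tightness enters here: each e in F is the only point of F on some line, hence the point chosen
   for that pair. *)
have gS e : exists e', g e' = e.
  have [eF|/elS[i <-]] := boolP (e \in F); last by exists (inl i).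
  have [i [j [/elS[a <-] /elS[b <-] ij hw]]] := tight_pair eF.
  rewrite (inj_eq el_inj) in ij; have [p hp] := pair_of ij.
  exists (inr p); have [zF zp _] := hzr p; apply: hw => //.
  by case: hp zp => -> //=; rewrite setUC.
have [psi iso] := pull_face_iso r L gS.
pose L' := pull g r @: L.
have hL' : oriented_matroid L' by apply: pull_om.
have triL' U (p : ipair n) : U \in L' ->
    tri (U (inl (val p).1)) (U (inl (val p).2)) (U (inr p)).
  by case/imsetP => X XL ->; rewrite !ffunE; have [_ _] := hzr p; apply.
have PL' : [ffun e => if e is inl _ then Pos else Zero] \in L'.
  apply/imsetP; exists P => //; apply/ffunP => -[i|p]; rewrite !ffunE /=.
    by have := elF i; rewrite FP inE; case: (P _).
  by have [zF _ _] := hzr p; move: zF; rewrite FP inE => /eqP->; rewrite if_same.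
exists n, [set pair_part U | U in L']; split=> //; split; first exact: sweep_of_pairs.
apply/FL_isomorphicP; exists (pull g r), psi.
by rewrite -eq_big_om_pairs.
Qed.

End HyperplaneToSweep.

Theorem theorem4p9 (E : finType) (L : {set signvec E})
    (hL : oriented_matroid L) (hsimple : simple_om L) :
  (exists (n : nat) (M : {set signvec (ipair n)}),
      0 < n /\ sweep_oriented_matroid M /\ FL_isomorphic L (big_om M)) <->
  (exists F : {set E}, tight_modular_hyperplane L F).
Proof.
split=> [[n [M [n0 [hM hFL]]]]|[F hF]]; first exact: tight_of_sweep n0 hM hFL.
exact: sweep_of_tight hF.
Qed.
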